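(* Let $X,Y$ be random variables on $\mathcal M$ with Fréchet means $\mu,\nu$, satisfying the standing assumptions in the context, and let $\alpha:[0,1]\to\mathcal M$ be the geodesic with $\alpha(0)=\mu$, $\alpha(1)=\nu$. Then for all points $p,q$ on $\alpha$, $$\operatorname{Cov}_{X,Y}(p)=\operatorname{Cov}_{X,Y}(q).$$
   Context: $\mathcal M$ is a complete, compact, finite-dimensional Riemannian manifold with distance $d$, Riemannian exponential/logarithm maps $\exp_p,\log_p$, and injectivity radius $\operatorname{inj}\mathcal M$. The Fréchet mean of a random variable $Z$ on $\mathcal M$ is the minimizer of $x\mapsto \mathbb E[d^2(x,Z)]$. Standing assumptions. (1) $X$ and $Y$ have unique Fréchet means $\mu$ and $\nu$; to ensure this, each of $X$ and $Y$ (every dataset drawn from it) is bounded in an open geodesic ball $B_r(p_0)$ (the balls may differ) with $r\le \frac12\min\{\operatorname{inj}\mathcal M,\pi/\sqrt\kappa\}$, where $\kappa$ is an upper bound on the sectional curvature; if $\kappa\le 0$, then $r$ must simply be finite. (2) $d(\mu,\nu)<\operatorname{inj}\mathcal M$, so that there is a unique minimizing geodesic $\alpha:[0,1]\to\mathcal M$ from $\mu$ to $\nu$. For points $p_1,p_2$ on $\alpha$, $\Gamma_{p_1}^{p_2}:T_{p_1}\mathcal M\to T_{p_2}\mathcal M$ is Levi-Civita parallel transport along $\alpha$. For $p\in\alpha$, the Riemannian cross-covariance is $$\Sigma_{X,Y}(p)=\mathbb E\big[(\Gamma_\mu^p\log_\mu X)(\Gamma_\nu^p\log_\nu Y)^T\big],$$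 where tangent vectors in $T_p\mathcal M$ are written in coordinates of an orthonormal basis (so $uv^T$ is the operator $w\mapsto\langle v,w\rangle_p u$), and the Riemannian covariance is $\operatorname{Cov}_{X,Y}(p)=\operatorname{tr}(\Sigma_{X,Y}(p))$. *)

(* Defs.v *)
From HB Require Import structures.
From mathcomp Require Import all_boot all_order all_algebra.
From mathcomp Require Import all_classical all_reals all_analysis.

Set Implicit Arguments.
Unset Strict Implicit.
Unset Printing Implicit Defensive.

Import Order.TTheory GRing.Theory Num.Theory.
Import numFieldNormedType.Exports.

Local Open Scope classical_set_scope.
Local Open Scope ring_scope.

Section Smooth.
Context {R : realType} {V W : normedModType R}.

(* f is C^k on U; only meant for open U. *)
Fixpoint Ck (k : nat) (U : set V) (f : V -> W) : Prop :=
  match k with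
  | 0 => forall x, U x -> {for x, continuous f}
  | k'.+1 => (forall x, U x -> differentiable f x) /\
             (forall v, Ck k' U ('D_v f))
  end.

Definition smooth (U : set V) (f : V -> W) := forall k, Ck k U f.

End Smooth.

Definition bilin (R : realType) (n : nat) (G : 'M[R]_n) (u v : 'rV[R]_n) : R :=
  (u *m G *m v^T) 0 0.

(* A smooth Riemannian manifold of dimension n on the space M.  The fields
   [phi i], [psi i] and [metric i] are junk outside of [dom i], resp. of the
   image of [dom i].  Second countability is not a field: it follows from
   compactness, which is assumed wherever the structure is used. *)
Record riemannian (R : realType) (n : nat) (M : topologicalType) := Riemannian {
  chart : Type;
  dom : chart -> set M;
  phi : chart -> M -> 'rV[R]_n;
  psi : chart -> 'rV[R]_n -> M;
  chart_at : M -> chart;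
  metric : chart -> 'rV[R]_n -> 'M[R]_n;
  manifold_hausdorff : hausdorff_space M;
  chart_at_dom : forall p, dom (chart_at p) p;
  dom_open : forall i, open (dom i);
  img_open : forall i, open (phi i @` dom i);
  phiK : forall i p, dom i p -> psi i (phi i p) = p;
  phi_continuous : forall i p, dom i p -> {for p, continuous (phi i)};
  psi_continuous :
    forall i p, dom i p -> {for phi i p, continuous (psi i)};
  transition_smooth :
    forall i j, smooth (phi i @` (dom i `&` dom j)) (phi j \o psi i);
  metric_smooth : forall i, smooth (phi i @` dom i) (metric i);
  metric_sym : forall i p, dom i p ->
    (metric i (phi i p))^T = metric i (phi i p);
  metric_pos : forall i p v, dom i p -> v != 0 ->
    0 < bilin (metric i (phi i p)) v v;
  metric_compat : forall i j p u v, dom i p -> dom j p ->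
    bilin (metric i (phi i p)) u v =
    bilin (metric j (phi j p)) ('D_u (phi j \o psi i) (phi i p))
                               ('D_v (phi j \o psi i) (phi i p))
}.

Section Geometry.
Context {R : realType} {n : nat} {M : topologicalType}.
Variable g : riemannian R n M.
Implicit Types (i : chart g) (p q : M) (x u v w : 'rV[R]_n) (c : R -> M).

(* T_p M is 'rV[R]_n, a tangent vector at p being given by its components in
   the chart [chart_at g p]; [in_chart i p u] gives its components in another
   chart i around p. *)
Definition in_chart i p u : 'rV[R]_n :=
  'D_u (phi i \o psi (chart_at g p)) (phi (chart_at g p) p).

Definition inner p u v : R :=
  bilin (metric (chart_at g p) (phi (chart_at g p) p)) u v.

Definition tnorm p u : R := Num.sqrt (inner p u u).

(* Levi-Civita connection: [christoffel i x u v] is the vector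
   (sum_(a, b) Gamma^k_(a b)(x) u_a v_b)_k in chart i, from the Koszul
   formula applied to constant fields. *)
Definition christoffel i x u v : 'rV[R]_n :=
  let G a b := fun y => bilin (metric i y) a b in
  2^-1 *: (\row_(l < n)
             let e := delta_mx 0 l in
             'D_u (G v e) x + 'D_v (G u e) x - 'D_e (G u v) x)
  *m invmx (metric i x).

(* R(u, v) w = nabla_u nabla_v w - nabla_v nabla_u w for u, v, w extended to
   constant (hence commuting) fields of chart i. *)
Definition curvature i x u v w : 'rV[R]_n :=
  ('D_u (fun y => christoffel i y v w) x
     + christoffel i x u (christoffel i x v w))
  - ('D_v (fun y => christoffel i y u w) x
     + christoffel i x v (christoffel i x u w)).

Definition area_sq p u v : R := inner p u u * inner p v v - inner p u v ^+ 2.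

Definition sectional_curvature p u v : R :=
  inner p (curvature (chart_at g p) (phi (chart_at g p) p) u v v) u
  / area_sq p u v.

(* [area_sq p u v] is nonzero iff u and v are linearly independent. *)
Definition sectional_curvature_le (kappa : R) : Prop :=
  forall p u v, area_sq p u v != 0 -> sectional_curvature p u v <= kappa.

(* Curves are parametrized by the whole real line; on a complete manifold this
   is no restriction for geodesics, nor for the C^1 curves on [0, 1] whose
   lengths define the distance. *)
Definition C1_curve c : Prop :=
  continuous c /\
  forall t i, dom i (c t) ->
    derivable (phi i \o c) t 1 /\ {for t, continuous (derive1 (phi i \o c))}.

Definition velocity c (t : R) : 'rV[R]_n := derive1 (phi (chart_at g (c t)) \o c) t.

Definition length c : R :=
  \int[lebesgue_measure]_(t in `[0, 1]) tnorm (c t) (velocity c t).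

(* +oo between distinct connected components *)
Definition dist p q : \bar R :=
  ereal_inf [set (length c)%:E | c in
              [set c | [/\ C1_curve c, c 0 = p & c 1 = q]]].

(* Levi-Civita parallelism along c of a field V with V t \in T_(c t) M *)
Definition parallel c (V : R -> 'rV[R]_n) : Prop :=
  forall t i, dom i (c t) ->
    let Vi := fun s => in_chart i (c s) (V s) in
    derivable Vi t 1 /\
    derive1 Vi t
      + christoffel i (phi i (c t)) (derive1 (phi i \o c) t) (Vi t) = 0.

Definition geodesic c : Prop := C1_curve c /\ parallel c (velocity c).

Definition complete_manifold : Prop :=
  forall p v, exists c, [/\ geodesic c, c 0 = p & velocity c 0 = v].

Definition rexp p v : M :=
  xget p [set q | exists c,
            [/\ geodesic c, c 0 = p, velocity c 0 = v & c 1 = q]].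

(* f restricts to a diffeomorphism from the open set U onto an open set of M *)
Definition diffeo_on (U : set 'rV[R]_n) (f : 'rV[R]_n -> M) : Prop :=
  [/\ open (f @` U),
      forall v, U v -> {for v, continuous f},
      forall i, smooth (U `&` f @^-1` dom i) (phi i \o f) &
      exists2 h : M -> 'rV[R]_n,
        forall v, U v -> h (f v) = v &
        forall i, smooth (phi i @` (dom i `&` f @` U)) (h \o psi i)].

Definition inj_radius_at p : \bar R :=
  ereal_sup [set r%:E | r in
              [set r | 0 <= r /\ diffeo_on [set v | tnorm p v < r] (rexp p)]].

Definition inj_radius : \bar R := ereal_inf (range inj_radius_at).

(* v is the initial velocity of a minimizing geodesic from p to q along which
   q is not conjugate to p *)
Definition is_log p q v : Prop :=
  [/\ rexp p v = q, (tnorm p v)%:E = dist p q &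
      exists U, [/\ open U, U v & diffeo_on U (rexp p)]].

(* The inverse of exp_p on the complement of the cut locus of p, which contains
   all q with dist p q < inj_radius_at p; 0 where there is no unique such
   v. *)
Definition rlog p q : 'rV[R]_n :=
  xget 0 [set v | is_log p q v /\ forall w, is_log p q w -> w = v].

(* Gamma_(c s)^(c t), along c *)
Definition transport c (s t : R) u : 'rV[R]_n :=
  xget 0 [set w | exists V, [/\ parallel c V, V s = u & V t = w]].

(* The rows of E form an orthonormal basis of T_p M. *)
Definition orthonormal_basis p (E : 'M[R]_n) : Prop :=
  forall a b : 'I_n, inner p (row a E) (row b E) = (a == b)%:R.

Definition coords p (E : 'M[R]_n) u : 'cV[R]_n := \col_a inner p u (row a E).

Definition minimizing_geodesic c p q : Prop :=
  [/\ geodesic c, c 0 = p, c 1 = q & (length c)%:E = dist p q].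

End Geometry.

Section Probability.
Context {R : realType} {n : nat} {M : topologicalType}.
Variable g : riemannian R n M.
Context {d : measure_display} {Omega : measurableType d}.
Variable P : probability Omega R.

(* Borel measurability *)
Definition random_point (Z : Omega -> M) : Prop :=
  forall U : set M, open U -> measurable (Z @^-1` U).

Definition frechet (Z : Omega -> M) (x : M) : \bar R :=
  (\int[P]_w (dist g x (Z w) ^+ 2))%E.

Definition unique_frechet_mean (Z : Omega -> M) (m : M) : Prop :=
  (forall x, (frechet Z m <= frechet Z x)%E) /\
  (forall m', (forall x, (frechet Z m' <= frechet Z x)%E) -> m' = m).

Definition in_geodesic_ball (Z : Omega -> M) (p0 : M) (r : R) : Prop :=
  {ae P, forall w, (dist g p0 (Z w) < r%:E)%E}.

(* Sigma_(X,Y)(c t) in the orthonormal basis E of the tangent space at c t, for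
   X, Y with Frechet means c 0, c 1 *)
Definition cross_covariance (c : R -> M) (X Y : Omega -> M) (t : R)
    (E : 'M[R]_n) : 'M[R]_n :=
  \matrix_(a, b)
    \int[P]_w
      (coords g (c t) E (transport g c 0 t (rlog g (c 0) (X w)))
       *m (coords g (c t) E (transport g c 1 t (rlog g (c 1) (Y w))))^T) a b.

Definition Cov (c : R -> M) (X Y : Omega -> M) (t : R) (E : 'M[R]_n) : R :=
  \tr (cross_covariance c X Y t E).

End Probability.

(* Main.v *)
(* Parallel transport along alpha preserves inner products, so, with
   u = log_mu X and v = log_nu Y,
     <Gamma_mu^p u, Gamma_nu^p v>_p
   does not depend on p.  By Parseval's identity in an orthonormal basis of
   T_p M, Cov_(X,Y)(p) is the expectation of this number, provided that the
   products of coordinates, whose expectations are the diagonal entries of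
   Sigma_(X,Y)(p), are integrable.

   Square integrability of log_mu X follows from |log_mu X| <= d(mu, X) and
   E[d(mu, X)^2] <= E[d(pX, X)^2] <= rX^2, as mu minimizes the Frechet function.
   Measurability of log_mu X: exp_mu is a homeomorphism on each of countably
   many small boxes that cover the regular points, d(mu, .) is upper
   semicontinuous since the end of a curve can be moved without increasing the
   length much, and log_mu is 0 where the minimizing vector is not unique.

   The existence of parallel transport is not needed: the vectors at a given
   time that extend to a parallel field form a linear subspace, on which
   transport is a linear isometry, and transport is 0 outside of it. *)

Require Import Defs.
From HB Require Import structures.
From mathcomp Require Import all_boot all_order all_algebra.
From mathcomp Require Import all_classical all_reals all_analysis.
From mathcomp Require Import measurable_realfun.
From mathcomp Require Import ring lra.

Set Implicit Arguments.
Unset Strict Implicit.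
Unset Printing Implicit Defensive.

Import Order.TTheory GRing.Theory Num.Theory.
Import numFieldNormedType.Exports.
Local Open Scope classical_set_scope.
Local Open Scope ring_scope.

(** * Matrix-valued limits and derivatives *)

(** A neighbourhood of a matrix contains a product of neighbourhoods of its entries, and a filter is
    closed under the finite intersection over the pairs of indices. *)
Lemma cvg_mx (R : realType) (T : Type) (F : set_system T) {FF : Filter F}
    (m n : nat) (f : T -> 'M[R]_(m, n)) (M : 'M[R]_(m, n)) :
  (forall i j, f x i j @[x --> F] --> M i j) -> f x @[x --> F] --> M.
Proof.
move=> fM A [P PM PA].
suff : \forall x \near F, forall ij : 'I_m * 'I_n, P ij.1 ij.2 (f x ij.1 ij.2).
  by apply: filterS => x Px; apply: PA => i j; exact: (Px (i, j)).
by apply: filter_forall => -[i j]; exact: (fM i j _ (PM i j)).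
Qed.

Lemma cvg_coord (R : realType) (T : Type) (F : set_system T) {FF : Filter F}
    (m n : nat) (f : T -> 'M[R]_(m, n)) (M : 'M[R]_(m, n)) i j :
  f x @[x --> F] --> M -> f x i j @[x --> F] --> M i j.
Proof. by move=> fM; exact: (cvg_comp _ _ fM (@coord_continuous _ _ _ i j M)). Qed.

Lemma cvg_mulmx (R : realType) (T : Type) (F : set_system T) {FF : Filter F}
    (m n p : nat) (f : T -> 'M[R]_(m, n)) (g : T -> 'M[R]_(n, p))
    (A : 'M[R]_(m, n)) (B : 'M[R]_(n, p)) :
  f x @[x --> F] --> A -> g x @[x --> F] --> B ->
  f x *m g x @[x --> F] --> A *m B.
Proof.
move=> fA gB; apply: cvg_mx => i j; rewrite mxE.
under eq_fun do rewrite mxE.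
apply: cvg_big => [|k _]; first exact: add_continuous.
by apply: cvgM; exact: cvg_coord.
Qed.

Lemma cvg_trmx (R : realType) (T : Type) (F : set_system T) {FF : Filter F}
    (m n : nat) (f : T -> 'M[R]_(m, n)) (A : 'M[R]_(m, n)) :
  f x @[x --> F] --> A -> (f x)^T @[x --> F] --> A^T.
Proof.
move=> fA; apply: cvg_mx => i j; rewrite mxE.
under eq_fun do rewrite mxE.
exact: cvg_coord.
Qed.

Lemma cvg_bilin (R : realType) (T : Type) (F : set_system T) {FF : Filter F}
    (n : nat) (G : T -> 'M[R]_n) (u v : T -> 'rV[R]_n)
    (A : 'M[R]_n) (a b : 'rV[R]_n) :
  G x @[x --> F] --> A -> u x @[x --> F] --> a -> v x @[x --> F] --> b ->
  bilin (G x) (u x) (v x) @[x --> F] --> bilin A a b.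
Proof.
move=> GA ua vb; apply: cvg_coord; apply: cvg_mulmx; last exact: cvg_trmx.
exact: cvg_mulmx.
Qed.

Lemma is_derive_coord (R : realType) (V : normedModType R) (m n : nat)
    (f : V -> 'M[R]_(m, n)) x v (df : 'M[R]_(m, n)) i j :
  is_derive x v f df -> is_derive x v (fun y => f y i j) (df i j).
Proof.
case=> dfx <-; apply: DeriveDef; first by have /derivable_mxP := dfx.
by rewrite derive_mx// mxE.
Qed.

Lemma is_derive_mx (R : realType) (V : normedModType R) (m n : nat)
    (f : V -> 'M[R]_(m, n)) x v (df : 'M[R]_(m, n)) :
  (forall i j, is_derive x v (fun y => f y i j) (df i j)) -> is_derive x v f df.
Proof.
move=> dfx; have df1 : derivable f x v.
  by apply/derivable_mxP => i j; have [] := dfx i j.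
apply: DeriveDef => //; apply/matrixP => i j.
by rewrite derive_mx// mxE; have [] := dfx i j.
Qed.

Lemma is_derive_mulmx (R : realType) (V : normedModType R) (m n p : nat)
    (f : V -> 'M[R]_(m, n)) (g : V -> 'M[R]_(n, p)) x v
    (df : 'M[R]_(m, n)) (dg : 'M[R]_(n, p)) :
  is_derive x v f df -> is_derive x v g dg ->
  is_derive x v (fun y => f y *m g y) (df *m g x + f x *m dg).
Proof.
move=> fx gx; apply: is_derive_mx => i j.
have -> : (fun y => (f y *m g y) i j) =
    \sum_k ((fun y => f y i k) * (fun y => g y k j)).
  by apply/funext => y; rewrite mxE fct_sumE.
have -> : (df *m g x + f x *m dg) i j =
    \sum_k (f x i k * dg k j + g x k j * df i k).
  rewrite !mxE -big_split /=; apply: eq_bigr => k _.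
  by rewrite addrC (mulrC (df i k)).
apply: is_derive_sum => k.
have := is_derive_coord i k fx; have := is_derive_coord k j gx => ? ?.
exact: is_deriveM.
Qed.

Lemma is_derive_trmx (R : realType) (V : normedModType R) (m n : nat)
    (f : V -> 'M[R]_(m, n)) x v (df : 'M[R]_(m, n)) :
  is_derive x v f df -> is_derive x v (fun y => (f y)^T) df^T.
Proof.
move=> fx; apply: is_derive_mx => i j; rewrite mxE.
by under eq_fun do rewrite mxE; exact: is_derive_coord.
Qed.

Lemma is_derive_bilin (R : realType) (V : normedModType R) (n : nat)
    (G : V -> 'M[R]_n) (a b : V -> 'rV[R]_n) x v
    (dG : 'M[R]_n) (da db : 'rV[R]_n) :
  is_derive x v G dG -> is_derive x v a da -> is_derive x v b db ->
  is_derive x v (fun y => bilin (G y) (a y) (b y))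
    (bilin dG (a x) (b x) + bilin (G x) da (b x) + bilin (G x) (a x) db).
Proof.
move=> Gx ax bx.
have H := is_derive_coord 0 0
  (is_derive_mulmx (is_derive_mulmx ax Gx) (is_derive_trmx bx)).
apply: (is_derive_eq H).
by rewrite /bilin mulmxDl 2!mxE [X in X + _]addrC -addrA addrA; congr (_ + _).
Qed.

Lemma is_derive_comp_curve (R : realType) (V W : normedModType R) (f : V -> W)
    (c : R -> V) t dc :
  differentiable f (c t) -> is_derive t 1 c dc ->
  is_derive t 1 (f \o c) ('D_dc f (c t)).
Proof.
move=> fd [cd cE].
have cd' : differentiable c t by apply/derivable1_diffP.
have fcd : differentiable (f \o c) t by exact: differentiable_comp.
apply: DeriveDef; first exact/derivable1_diffP.
by rewrite deriveE// diff_comp// deriveE//= -cE deriveE.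
Qed.

Lemma derive_linear (R : realType) (V W : normedModType R) (f : V -> W) x :
  differentiable f x -> linear (fun v => 'D_v f x).
Proof. by move=> fd a u v; rewrite !deriveE// linearP. Qed.

Lemma smooth_diff (R : realType) (V W : normedModType R) (U : set V) (f : V -> W) x :
  smooth U f -> U x -> differentiable f x.
Proof. by move=> /(_ 1%N)[fd _]; exact: fd. Qed.

Lemma smooth_derive_continuous (R : realType) (V W : normedModType R)
    (U : set V) (f : V -> W) v x :
  smooth U f -> U x -> {for x, continuous ('D_v f)}.
Proof. by move=> /(_ 1%N)[_ fd]; exact: fd. Qed.

(** * Parallel fields *)

Section BilinTheory.
Context {R : realType} {n : nat}.
Implicit Types (G : 'M[R]_n) (u v w : 'rV[R]_n).

Lemma bilinDl G u v w : bilin G (u + v) w = bilin G u w + bilin G v w.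
Proof. by rewrite /bilin !mulmxDl mxE. Qed.

Lemma bilinDr G u v w : bilin G u (v + w) = bilin G u v + bilin G u w.
Proof. by rewrite /bilin linearD mulmxDr mxE. Qed.

Lemma bilinZl G a u v : bilin G (a *: u) v = a * bilin G u v.
Proof. by rewrite /bilin -!scalemxAl mxE. Qed.

Lemma bilinZr G a u v : bilin G u (a *: v) = a * bilin G u v.
Proof. by rewrite /bilin linearZ -scalemxAr mxE. Qed.

Lemma bilinNl G u v : bilin G (- u) v = - bilin G u v.
Proof. by rewrite -scaleN1r bilinZl mulN1r. Qed.

Lemma bilinNr G u v : bilin G u (- v) = - bilin G u v.
Proof. by rewrite -scaleN1r bilinZr mulN1r. Qed.

Lemma bilin0l G u : bilin G 0 u = 0.
Proof. by rewrite /bilin !mul0mx mxE. Qed.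

Lemma bilin0r G u : bilin G u 0 = 0.
Proof. by rewrite /bilin trmx0 mulmx0 mxE. Qed.

Lemma bilin_trmx G u v : bilin G^T u v = bilin G v u.
Proof.
rewrite /bilin; have -> : u *m G^T *m v^T = (v *m G *m u^T)^T.
  by rewrite !trmx_mul trmxK mulmxA.
by rewrite mxE.
Qed.

Lemma bilin_sumr G u v : bilin G u v = \sum_k v 0 k * bilin G u (delta_mx 0 k).
Proof.
rewrite {1}[v]row_sum_delta /bilin linear_sum mulmx_sumr summxE.
by apply: eq_bigr => k _; rewrite linearZ -scalemxAr mxE.
Qed.

(** A nonzero row vector in the kernel of G would have square norm 0. *)
Lemma posdef_unitmx G : (forall v, v != 0 -> 0 < bilin G v v) -> G \in unitmx.
Proof.
move=> Gpos; rewrite -row_free_unit -kermx_eq0; apply/negPn/negP => K0.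
have v0 : nz_row (kermx G) != 0 by rewrite nz_row_eq0.
have : nz_row (kermx G) *m G = 0 by apply/sub_kermxP; exact: nz_row_sub.
by move=> vG; have := Gpos _ v0; rewrite /bilin vG mul0mx mxE ltxx.
Qed.

End BilinTheory.

(** * The metric and its Christoffel symbols in a chart *)

Section ChartTheory.
Context {R : realType} {n : nat} {M : topologicalType}.
Variable g : riemannian R n M.
Implicit Types (i j : chart g) (p q : M) (x u v w : 'rV[R]_n) (c : R -> M).

Lemma transition_differentiable i j p :
  dom i p -> dom j p -> differentiable (phi j \o psi i) (phi i p).
Proof.
move=> ip jp; apply: smooth_diff (@transition_smooth _ _ _ g i j) _.
by exists p.
Qed.

Lemma metric_differentiable i p : dom i p -> differentiable (metric i) (phi i p).
Proof. by move=> ip; apply: smooth_diff (@metric_smooth _ _ _ g i) _; exists p. Qed.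

Lemma metric_unitmx i p : dom i p -> metric i (phi i p) \in unitmx.
Proof. by move=> ip; apply: posdef_unitmx => v v0; exact: metric_pos. Qed.

Lemma near_image i p : dom i p ->
  \forall x \near phi i p, (phi i @` dom i) x.
Proof. by move=> ip; apply: open_nbhs_nbhs; split; [exact: img_open|exists p]. Qed.

Lemma near_dom i p : dom i p -> \forall q \near p, dom i q.
Proof. by move=> ip; apply: open_nbhs_nbhs; split => //; exact: dom_open. Qed.

Lemma inner_in_chart i p u v : dom i p ->
  inner g p u v = bilin (metric i (phi i p)) (in_chart i p u) (in_chart i p v).
Proof. by move=> ip; apply: metric_compat => //; exact: chart_at_dom. Qed.

Lemma in_chart_linear i p : dom i p -> linear (in_chart i p).
Proof.
move=> ip; apply: derive_linear.
by apply: transition_differentiable => //; exact: chart_at_dom.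
Qed.

Lemma bilin_metricC i p u v : dom i p ->
  bilin (metric i (phi i p)) u v = bilin (metric i (phi i p)) v u.
Proof. by move=> ip; rewrite -[RHS]bilin_trmx Defs.metric_sym. Qed.

Lemma inner_ge0 p u : 0 <= inner g p u u.
Proof.
have [->|u0] := eqVneq u 0; first by rewrite /inner bilin0l.
by apply/ltW/metric_pos => //; exact: chart_at_dom.
Qed.

Lemma inner_eq0 p u : inner g p u u = 0 -> u = 0.
Proof.
move=> u0; apply: contra_eq (u0) => un0; rewrite gt_eqF//.
by apply: metric_pos => //; exact: chart_at_dom.
Qed.

(** For constant fields a, b of the chart this is the term u(g(a, b)) of the Koszul formula. *)
Definition dmetric i x u a b := bilin ('D_u (metric i) x) a b.

Lemma is_derive_metric i p u a b : dom i p ->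
  is_derive (phi i p) u (fun y => bilin (metric i y) a b)
    (dmetric i (phi i p) u a b).
Proof.
move=> ip; have /diff_derivable md := metric_differentiable ip.
have H := is_derive_bilin (derivableP (md u)) (is_derive_cst a (phi i p) u)
  (is_derive_cst b (phi i p) u).
apply: (is_derive_eq H).
by rewrite bilin0l bilin0r !addr0.
Qed.

(** Symmetry of [metric i] is known on the image of the chart only. This set is open, so the two
    functions agree near the point and have the same derivative. *)
Lemma dmetricC i p u a b : dom i p ->
  dmetric i (phi i p) u a b = dmetric i (phi i p) u b a.
Proof.
move=> ip; have [_ <-] := is_derive_metric u a b ip.
have [_ <-] := is_derive_metric u b a ip.
apply: near_eq_derive; near=> y.
have [q iq <-] : (phi i @` dom i) y by near: y; exact: near_image.
by rewrite -bilin_trmx Defs.metric_sym.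
Unshelve. all: by end_near. Qed.

Lemma dmetric_linear1 i p a u u' v w : dom i p ->
  dmetric i (phi i p) (a *: u + u') v w =
  a * dmetric i (phi i p) u v w + dmetric i (phi i p) u' v w.
Proof.
move=> ip; rewrite /dmetric (derive_linear (metric_differentiable ip) a u u').
by rewrite {1}/bilin mulmxDr mulmxDl mxE -scalemxAr -scalemxAl [X in X + _]mxE.
Qed.

Lemma dmetric_linear2 i x u a v v' w :
  dmetric i x u (a *: v + v') w = a * dmetric i x u v w + dmetric i x u v' w.
Proof. by rewrite /dmetric bilinDl bilinZl. Qed.

Lemma dmetric_linear3 i x u v a w w' :
  dmetric i x u v (a *: w + w') = a * dmetric i x u v w + dmetric i x u v w'.
Proof. by rewrite /dmetric bilinDr bilinZr. Qed.

Lemma dmetric_sum i p a b w : dom i p ->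
  dmetric i (phi i p) w a b =
  \sum_k w 0 k * dmetric i (phi i p) (delta_mx 0 k) a b.
Proof.
move=> ip; have mdiff := metric_differentiable ip.
rewrite /dmetric deriveE// {1}[w]row_sum_delta linear_sum /bilin mulmx_sumr.
rewrite mulmx_suml summxE; apply: eq_bigr => k _.
by rewrite linearZ/= -deriveE// -scalemxAr -scalemxAl mxE.
Qed.

(** The Koszul formula: the inverse matrix in [christoffel] cancels against the metric, and the
    components along the basis vectors extend to w by linearity. *)
Lemma bilin_christoffel i p u v w : dom i p ->
  bilin (metric i (phi i p)) (christoffel i (phi i p) u v) w =
  2^-1 * (dmetric i (phi i p) u v w + dmetric i (phi i p) v u w
          - dmetric i (phi i p) w u v).
Proof.
move=> ip; rewrite /christoffel {1}/bilin mulmxKV ?metric_unitmx//.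
rewrite -scalemxAl mxE; congr (_ * _).
rewrite (dmetric_sum u v w ip) [dmetric _ _ u v w]bilin_sumr.
rewrite [dmetric _ _ v u w]bilin_sumr -big_split -sumrB mxE /=.
apply: eq_bigr => k _; rewrite !mxE.
have D z a b : 'D_z (fun y => bilin (metric i y) a b) (phi i p) =
    dmetric i (phi i p) z a b by have [] := is_derive_metric z a b ip.
by rewrite !D mulrC mulrBr mulrDr.
Qed.

(** Compatibility of the Levi-Civita connection with the metric. In the sum of the two Koszul
    formulas the derivatives in the directions v and w cancel. *)
Lemma christoffel_metric i p u v w : dom i p ->
  bilin (metric i (phi i p)) (christoffel i (phi i p) u v) w +
  bilin (metric i (phi i p)) v (christoffel i (phi i p) u w) =
  dmetric i (phi i p) u v w.
Proof.
move=> ip; rewrite (bilin_metricC v _ ip).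
apply: etrans (congr2 +%R (bilin_christoffel u v w ip)
  (bilin_christoffel u w v ip)) _.
rewrite (dmetricC u w v ip).
have F (x y z : R) : 2^-1 * (x + y - z) + 2^-1 * (x + z - y) = x by field.
exact: F.
Qed.

Lemma metric_inj i p u v : dom i p ->
  (forall w, bilin (metric i (phi i p)) u w = bilin (metric i (phi i p)) v w) ->
  u = v.
Proof.
move=> ip uv; apply/eqP; rewrite -subr_eq0; apply: contraT => uv0.
have := metric_pos ip uv0; rewrite {1}bilinDl bilinNl uv addrN.
by rewrite ltxx.
Qed.

(** The metric is nondegenerate, so linearity may be tested after pairing with w, where the Koszul
    formula makes it visible. *)
Lemma christoffel_linear i p u : dom i p ->
  linear (christoffel i (phi i p) u).
Proof.
move=> ip a v v'; apply: (metric_inj ip) => w.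
(* [christoffel] is generalized, since unification would otherwise unfold it *)
move: (bilin_christoffel u v w ip) (bilin_christoffel u v' w ip).
move: (bilin_christoffel u (a *: v + v') w ip).
move: (christoffel _ _ _ v) (christoffel _ _ _ v') (christoffel _ _ _ _) => A B C.
move=> -> EA EB; rewrite bilinDl bilinZl EA EB.
rewrite (dmetric_linear1 a v v' u w ip) (dmetric_linear2 i (phi i p) u a v v' w).
rewrite (dmetric_linear3 i (phi i p) w u a v v').
have F (x y z x' y' z' : R) : 2^-1 * ((a * x + x') + (a * y + y') - (a * z + z'))
  = a * (2^-1 * (x + y - z)) + 2^-1 * (x' + y' - z') by field.
exact: F.
Qed.

Lemma near_curve_dom i c t : {for t, continuous c} -> dom i (c t) ->
  \forall s \near t, dom i (c s).
Proof. by move=> cc ic; apply: cc; exact: near_dom. Qed.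

Lemma is_derive_change_chart i j c t z : {for t, continuous c} ->
  dom i (c t) -> dom j (c t) -> is_derive t 1 (phi i \o c) z ->
  is_derive t 1 (phi j \o c) ('D_z (phi j \o psi i) (phi i (c t))).
Proof.
move=> cc ic jc cz; have jid := transition_differentiable ic jc.
have := is_derive_comp_curve jid cz; apply: near_eq_is_derive; near=> s.
rewrite /= phiK//; near: s; exact: near_curve_dom.
Unshelve. all: by end_near. Qed.

End ChartTheory.

(** * Parallel fields along a curve *)

Section Parallel.
Context {R : realType} {n : nat} {M : topologicalType}.
Variables (g : riemannian R n M) (c : R -> M).
Hypothesis cC1 : C1_curve g c.
Implicit Types (V W : R -> 'rV[R]_n).

(** The derivative of the inner product vanishes: the product rule gives the derivative of the
    metric along c plus the terms in V' and W'. The parallel equation turns the latter into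
    Christoffel terms, which cancel the former by [christoffel_metric]. *)
Lemma parallel_inner V W s t : parallel g c V -> parallel g c W ->
  inner g (c s) (V s) (W s) = inner g (c t) (V t) (W t).
Proof.
move=> pV pW; apply: (@is_derive_0_is_cst _ (fun t => inner g (c t) (V t) (W t))).
move=> {s}t; set i := chart_at g (c t).
have ic : dom i (c t) by exact: chart_at_dom.
have [Vd /(canRL (addrK _)) Ve'] := pV t i ic.
have [Wd /(canRL (addrK _)) We'] := pW t i ic.
have [cd _] := cC1.2 t i ic.
set Vi := (fun s => in_chart i (c s) (V s)) in Vd Ve'.
set Wi := (fun s => in_chart i (c s) (W s)) in Wd We'.
have md := metric_differentiable ic.
have G1 := is_derive_comp_curve md (derivableP cd).
have VWd := is_derive_bilin G1 (derivableP Vd) (derivableP Wd).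
suff H0 :
    bilin ('D_('D_1 (phi i \o c) t) (metric i) (phi i (c t))) (Vi t) (Wi t) +
    bilin ((metric i \o (phi i \o c)) t) ('D_1 Vi t) (Wi t) +
    bilin ((metric i \o (phi i \o c)) t) (Vi t) ('D_1 Wi t) = 0.
  have := is_derive_eq VWd H0.
  (* [inner] at c s is computed in a chart that depends on s; near t it can be read in the fixed
     chart i. *)
  apply: near_eq_is_derive; near=> s; rewrite /= (@inner_in_chart _ _ _ g i)//.
  by near: s; apply: near_curve_dom => //; exact: cC1.1.
rewrite (derive1E Vi) (derive1E (phi i \o c)) sub0r in Ve'.
rewrite (derive1E Wi) (derive1E (phi i \o c)) sub0r in We'.
rewrite Ve' We'.
move: (christoffel_metric ('D_1 (phi i \o c) t) (Vi t) (Wi t) ic).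
move: (christoffel _ _ _ (Vi t)) (christoffel _ _ _ (Wi t)) => A B E.
by rewrite bilinNl bilinNr -addrA -opprD E subrr.
Unshelve. all: by end_near. Qed.

Lemma parallel_linear V W a : parallel g c V -> parallel g c W ->
  parallel g c (fun t => a *: V t + W t).
Proof.
move=> pV pW t i ic Vi; have [Vd Ve] := pV t i ic; have [Wd We] := pW t i ic.
have H : is_derive t 1 Vi (a *: derive1 (fun s => in_chart i (c s) (V s)) t
                           + derive1 (fun s => in_chart i (c s) (W s)) t).
  rewrite (derive1E (fun s => in_chart i (c s) (V s))).
  rewrite (derive1E (fun s => in_chart i (c s) (W s))).
  apply: near_eq_is_derive
    (is_deriveD (is_deriveZ a (derivableP Vd)) (derivableP Wd)).
  near=> s; rewrite /Vi in_chart_linear//.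
  by near: s; apply: near_curve_dom => //; exact: cC1.1.
have [Hd He] := H; split; first exact: Hd.
rewrite derive1E He /Vi (in_chart_linear ic) (christoffel_linear _ ic).
move: Ve We => /=.
move: (christoffel _ _ _ (in_chart i (c t) (V t))).
move: (christoffel _ _ _ (in_chart i (c t) (W t))).
move: (derive1 (fun s => in_chart i (c s) (V s)) t).
move: (derive1 (fun s => in_chart i (c s) (W s)) t) => {He Hd H} A B C D BD AC.
by rewrite addrACA -scalerDr BD AC scaler0 addr0.
Unshelve. all: by end_near. Qed.

End Parallel.

(** Turns a linear map on a subspace, both given without coordinates, into matrices: B cuts out the
    subspace and A computes the map there. For parallel transport this reduces measurability to
    continuous functions. *)
Lemma subspace_linear_mx (F : fieldType) (n m : nat) (S : set 'rV[F]_n)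
    (T : 'rV[F]_n -> 'rV[F]_m) :
  S 0 ->
  (forall a u v, S u -> S v ->
     S (a *: u + v) /\ T (a *: u + v) = a *: T u + T v) ->
  exists (A : 'M[F]_(n, m)) (B : 'M[F]_n),
    forall u, (S u <-> u *m B = 0) /\ (S u -> T u = u *m A).
Proof.
move=> S0 Slin.
have T0 : T 0 = 0.
  by have [_] := Slin (-1) 0 0 S0 S0; rewrite scaler0 addr0 scaleN1r addNr.
(* K is taken of maximal rank among the matrices whose row space lies in S; its row space is then
   all of S. *)
pose Q (r : nat) := exists2 K : 'M[F]_n, \rank K = r &
  forall u, (u <= K)%MS -> S u.
pose P r := `[< Q r >].
have P0 : P 0%N.
  by apply/asboolP; exists 0; rewrite ?mxrank0// => u; rewrite submx0 => /eqP ->.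
have Pn r : P r -> (r <= n)%N by move=> /asboolP[K <- _]; exact: rank_leq_row.
case: (ex_maxnP (ex_intro P 0%N P0) Pn) => r /asboolP[K Kr KS] rmax.
have SK u : S u <-> (u <= K)%MS.
  split=> [Su|]; last exact: KS.
  apply: contraT => uK.
  (* A vector u of S outside of K would yield a larger row space inside S. *)
  have : P (\rank (K + u)%MS).
    apply/asboolP; exists (K + u)%MS => // w /sub_addsmxP[[a b] /= ->].
    rewrite addrC [b]mx11_scalar mul_scalar_mx.
    by have [] := Slin (b 0 0) u (a *m K) Su (KS _ (submxMl _ _)).
  move=> /rmax; rewrite -Kr leqNgt => /negP[]; apply: rank_ltmx.
  rewrite ltmxE addsmxSl/=; apply: contra uK; exact/submx_trans/addsmxSr.
pose TK := \matrix_i T (row i K).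
have TE x : T (x *m K) = x *m TK.
  suff : S (\sum_i x 0 i *: row i K) /\
      T (\sum_i x 0 i *: row i K) = \sum_i x 0 i *: row i TK.
    by rewrite -!mulmx_sum_row => -[].
  elim/big_ind2 : _ => //.
  - move=> Tu u Tv v [Su <-] [Sv <-].
    by have := Slin 1 u v Su Sv; rewrite !scale1r.
  - move=> i _; rewrite rowK.
    have Si : S (row i K) by apply/SK; exact: row_sub.
    by have := Slin (x 0 i) _ 0 Si S0; rewrite !addr0 T0 addr0.
(* [pinvmx K] gives coefficients of u on the rows of K, and [cokermx K] annihilates exactly the row
   space of K. *)
exists (pinvmx K *m TK), (cokermx K) => u; split.
  by rewrite SK submxE; split => [/eqP|/eqP].
by move=> /SK uK; rewrite mulmxA -TE mulmxKpV.
Qed.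

(** * Parallel transport along a curve *)

Section Transport.
Context {R : realType} {n : nat} {M : topologicalType}.
Variables (g : riemannian R n M) (c : R -> M).
Hypothesis cC1 : C1_curve g c.
Implicit Types (u v : 'rV[R]_n) (a b s t : R).

Lemma parallel0 : parallel g c (fun=> 0).
Proof.
move=> t i ic Vi.
have lin0 (f : 'rV[R]_n -> 'rV[R]_n) : linear f -> f 0 = 0.
  by move=> /(_ (-1) 0 0); rewrite scaler0 addr0 scaleN1r addNr.
have H : is_derive t 1 Vi 0.
  apply: near_eq_is_derive (is_derive_cst 0 t 1).
  near=> s; rewrite /Vi lin0//; apply: in_chart_linear.
  by near: s; apply: near_curve_dom => //; exact: cC1.1.
have [Hd He] := H; split; first exact: Hd.
rewrite derive1E He /Vi (lin0 _ (in_chart_linear ic)).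
by rewrite (lin0 _ (christoffel_linear _ ic)) addr0.
Unshelve. all: by end_near. Qed.

(** The difference of the two fields is parallel, hence of constant norm, and it vanishes at s. *)
Lemma parallel_unique V W s t : parallel g c V -> parallel g c W ->
  V s = W s -> V t = W t.
Proof.
move=> pV pW VW; apply/eqP; rewrite -subr_eq0 -scaleN1r addrC; apply/eqP.
have pD := parallel_linear cC1 (-1) pW pV.
apply: (@inner_eq0 _ _ _ g (c t)).
rewrite (parallel_inner cC1 t s pD pD) VW scaleN1r addNr.
by rewrite /inner bilin0l.
Qed.

Lemma transport_parallel V s t : parallel g c V ->
  transport g c s t (V s) = V t.
Proof.
move=> pV; apply: xget_unique; first by exists V.
by move=> w [W [pW WV <-]]; exact: parallel_unique pW pV WV.
Qed.

Lemma transport_out s t u : ~ (exists2 V, parallel g c V & V s = u) ->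
  transport g c s t u = 0.
Proof.
by move=> nV; apply: xgetPN => w [V [pV Vs _]]; apply: nV; exists V.
Qed.

(** If both vectors extend to parallel fields, this is [parallel_inner]. Otherwise one of them is
    sent to 0 at every target time, since extendability depends on the initial time and vector
    alone, and both sides are 0. *)
Lemma transport_inner a b s t u v :
  inner g (c s) (transport g c a s u) (transport g c b s v) =
  inner g (c t) (transport g c a t u) (transport g c b t v).
Proof.
have [[V pV <-]|nu] := pselect (exists2 V, parallel g c V & V a = u).
  have [[W pW <-]|nv] := pselect (exists2 V, parallel g c V & V b = v).
    by rewrite !transport_parallel//; exact: parallel_inner.
  by rewrite !(transport_out _ nv) /inner !bilin0r.
by rewrite !(transport_out _ nu) /inner !bilin0l.
Qed.

(** Equality holds for vectors that extend to a parallel field; the others are sent to 0. *)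
Lemma transport_norm a t u :
  inner g (c t) (transport g c a t u) (transport g c a t u) <=
  inner g (c a) u u.
Proof.
rewrite (transport_inner a a t a).
have [[V pV <-]|nu] := pselect (exists2 V, parallel g c V & V a = u).
  by rewrite transport_parallel.
by rewrite !(transport_out _ nu) {1}/inner bilin0l inner_ge0.
Qed.

Lemma transport_mx a t : exists A B : 'M[R]_n, forall u,
  transport g c a t u = if u *m B == 0 then u *m A else 0.
Proof.
have [|x u v [V pV <-] [W pW <-]|A [B AB]] := @subspace_linear_mx R n n
  [set u | exists2 V, parallel g c V & V a = u] (transport g c a t).
- by exists (fun=> 0) => //; exact: parallel0.
- have pD := parallel_linear cC1 x pV pW.
  split; first by exists (fun t => x *: V t + W t).
  rewrite (transport_parallel a t pV) (transport_parallel a t pW).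
  exact: (transport_parallel a t pD).
- exists A, B => u; have [SB TA] := AB u; case: eqP => [/SB|uB]; first exact: TA.
  by apply: transport_out => /SB.
Qed.

End Transport.

(** * Curves of class C^1 *)

(** Away from 0 the function is the square up to sign; at 0 its difference quotient is |h|, which
    tends to 0. *)
Lemma is_derive_mulr_norm (R : realType) (x : R) :
  is_derive x 1 (fun y => y * `|y|) (2 * `|x|).
Proof.
have [x0|x0|->] := ltgtP x 0.
- have -> : 2 * `|x| = - (x *: 1 + x *: 1).
    by rewrite ltr0_norm// /GRing.scale/=; ring.
  apply: near_eq_is_derive
    (is_deriveN (is_deriveM (is_derive_id x 1) (is_derive_id x 1))).
  near=> y; rewrite ltr0_norm ?mulrN//.
  by near: y; exact: lt_nbhsl.
- have -> : 2 * `|x| = x *: 1 + x *: 1.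
    by rewrite gtr0_norm// /GRing.scale/=; ring.
  apply: near_eq_is_derive (is_deriveM (is_derive_id x 1) (is_derive_id x 1)).
  near=> y; rewrite gtr0_norm//.
  by near: y; exact: lt_nbhsr.
- rewrite normr0 mulr0.
  pose q (y : R^o) : R^o := y * `|y|.
  have H : h^-1 *: (q (h *: (1 : R^o) + 0) - q 0) @[h --> (0 : R)^'] --> (0 : R^o).
    apply: (@cvg_trans _ ((fun h : R => `|h|) @ 0^')).
      apply: near_eq_cvg; near=> h.
      rewrite /q mul0r subr0 addr0 /GRing.scale/= mulr1 mulKf//.
      by near: h; exact: nbhs_dnbhs_neq.
    apply: (@cvg_within_filter _ _ (fun h : R => `|h|) (nbhs (0 : R))).
    by have := @norm_continuous _ R 0; rewrite /continuous_at normr0.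
  by apply: DeriveDef; [apply/cvg_ex; exists 0|exact: cvg_lim].
Unshelve. all: by end_near. Qed.

(** The cut-off by which the end of a curve is moved within the class [C1_curve]. *)
Lemma C1_bump (R : realType) (a r : R) : 0 < r ->
  exists eta deta : R -> R,
    [/\ forall t : R, is_derive t 1 eta (deta t), continuous deta, eta a = 1 &
        forall t : R, r <= `|t - a| -> eta t = 0].
Proof.
move=> r0.
pose z (t : R) : R := 1 - (r^-1 * (t - a)) * (r^-1 * (t - a)).
pose dz (t : R) : R := - (2 * (r^-1 * (t - a)) * r^-1).
have zd (t : R) : is_derive t 1 z (dz t).
  have H : is_derive t 1 (fun t : R => r^-1 * (t - a)) r^-1.
    have := is_deriveZ r^-1
      (is_deriveB (is_derive_id t 1) (is_derive_cst a t 1)).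
    by rewrite subr0 /GRing.scale/= mulr1.
  have H2 := is_deriveB (is_derive_cst (1 : R^o) t 1) (is_deriveM H H).
  by apply: (is_derive_eq H2); rewrite /dz /GRing.scale/=; ring.
have zc : continuous z.
  by move=> t; apply: differentiable_continuous; apply/derivable1_diffP; have [] := zd t.
(* (z^2 + z |z|) / 2 is the square of max(0, z), hence C^1 in z *)
exists (fun t : R => 2^-1 * (z t * z t + z t * `|z t|)).
exists (fun t : R => 2^-1 * (2 * z t * dz t + 2 * `|z t| * dz t)); split.
- move=> t.
  have H1 := is_deriveM (zd t) (zd t).
  have H2 : is_derive t 1 ((fun y => y * `|y|) \o z) (2 * `|z t| * dz t).
    have := is_derive1_comp (is_derive_mulr_norm (z t)) (zd t).
    by rewrite /GRing.scale/= mulrC.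
  have H3 := is_deriveZ 2^-1 (is_deriveD H1 H2).
  by apply: (is_derive_eq H3); rewrite /GRing.scale/=; ring.
- move=> t; have dzc : {for t, continuous dz}.
    apply: cvgN; apply: cvgM; last exact: cvg_cst.
    apply: cvgM; first exact: cvg_cst.
    apply: cvgM; first exact: cvg_cst.
    by apply: cvgB; [exact: cvg_id|exact: cvg_cst].
  apply: cvgM; first exact: cvg_cst.
  apply: cvgD; apply: cvgM => //; apply: cvgM; try exact: cvg_cst.
    exact: zc.
  by apply: cvg_norm; exact: zc.
- by rewrite /z subrr !mulr0 subr0 normr1; field.
- move=> t rt.
  have : z t <= 0.
    have h1 : 1 <= `|r^-1 * (t - a)|.
      by rewrite normrM (gtr0_norm (_ : 0 < r^-1)) ?invr_gt0// ler_pdivlMl// mulr1.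
    by rewrite /z subr_le0 -expr2 -real_normK ?num_real// exprn_ege1.
  by move=> /ler0_norm ->; rewrite mulrN subrr mulr0.
Qed.

Lemma integrable_continuous01 (R : realType) (f : R -> R) : continuous f ->
  lebesgue_measure.-integrable `[0, 1] (EFin \o f).
Proof.
move=> fc; apply: continuous_compact_integrable; first exact: segment_compact.
exact: continuous_subspaceT.
Qed.

(** * Speed and regularity of curves in charts *)

Section Curves.
Context {R : realType} {n : nat} {M : topologicalType}.
Variable g : riemannian R n M.
Implicit Types (i j : chart g) (p q : M) (c : R -> M) (t : R).

Lemma chart_derive_velocity i c t : C1_curve g c -> dom i (c t) ->
  derive1 (phi i \o c) t = in_chart i (c t) (velocity g c t).
Proof.
move=> [cc cd] ic; have kc := chart_at_dom g (c t).
have [kd _] := cd t _ kc.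
have [_ H] := is_derive_change_chart (cc t) kc ic (derivableP kd).
by rewrite derive1E H /in_chart /velocity derive1E.
Qed.

Lemma speedE i c t : C1_curve g c -> dom i (c t) ->
  tnorm g (c t) (velocity g c t) =
  Num.sqrt (bilin (metric i (phi i (c t))) (derive1 (phi i \o c) t)
                  (derive1 (phi i \o c) t)).
Proof.
by move=> cC ic; rewrite /tnorm (inner_in_chart _ _ ic) -chart_derive_velocity.
Qed.

Lemma cvg_speed (T : Type) (F : set_system T) {FF : Filter F} i p
    (x z : T -> 'rV[R]_n) z0 :
  dom i p -> x s @[s --> F] --> phi i p -> z s @[s --> F] --> z0 ->
  Num.sqrt (bilin (metric i (x s)) (z s) (z s)) @[s --> F] -->
  Num.sqrt (bilin (metric i (phi i p)) z0 z0).
Proof.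
move=> ip xp zz; apply: continuous_cvg; first exact: sqrt_continuous.
have mc := differentiable_continuous (metric_differentiable ip).
have xm : metric i (x s) @[s --> F] --> metric i (phi i p).
  exact: (cvg_comp _ _ xp mc).
exact: (@cvg_bilin _ _ F FF _ _ _ _ _ _ _ xm zz zz).
Qed.

(** The chart in which [velocity] is expressed may jump with t, so continuity is checked near t in
    one fixed chart, by [speedE]. *)
Lemma speed_continuous c : C1_curve g c ->
  continuous (fun t => tnorm g (c t) (velocity g c t)).
Proof.
move=> cC t; have ic := chart_at_dom g (c t); set i := chart_at g (c t) in ic.
have [_ zc] := cC.2 t i ic.
rewrite /continuous_at (speedE cC ic).
apply: (@cvg_trans _ ((fun s => Num.sqrt (bilin (metric i (phi i (c s)))
   (derive1 (phi i \o c) s) (derive1 (phi i \o c) s))) @ t)).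
  apply: near_eq_cvg; near=> s; rewrite -speedE//.
  by near: s; apply: near_curve_dom => //; exact: cC.1.
have xc : phi i (c s) @[s --> t] --> phi i (c t).
  exact: (cvg_comp _ _ (cC.1 t) (phi_continuous ic)).
exact: (@cvg_speed _ _ (nbhs_filter t) _ _ _ _ _ ic xc zc).
Unshelve. all: by end_near. Qed.

Lemma integrable_speed c : C1_curve g c ->
  lebesgue_measure.-integrable `[0, 1]
    (EFin \o (fun t => tnorm g (c t) (velocity g c t))).
Proof. by move=> cC; apply: integrable_continuous01; exact: speed_continuous. Qed.

(** The pointwise form of [C1_curve]; being local, it applies to curves glued from pieces. *)
Definition C1_at c t := {for t, continuous c} /\
  forall i, dom i (c t) ->
    derivable (phi i \o c) t 1 /\ {for t, continuous (derive1 (phi i \o c))}.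

Lemma C1_curve_at c : C1_curve g c <-> forall t, C1_at c t.
Proof.
split=> [[cc cd] t|H]; first by split; [exact: cc|exact: cd].
by split=> t; [have [] := H t|have [] := H t].
Qed.

Lemma near_eq_continuous_at (T U : topologicalType) (f h : T -> U) x :
  (\forall y \near x, f y = h y) -> {for x, continuous f} ->
  {for x, continuous h}.
Proof.
move=> fh fx; rewrite /prop_for /continuous_at -(nbhs_singleton fh).
by apply: cvg_trans fx; apply: near_eq_cvg; apply: filterS fh => y.
Qed.

Lemma C1_at_near c c' t : (\forall s \near t, c s = c' s) -> C1_at c t -> C1_at c' t.
Proof.
move=> cc' [cc cd]; split; first exact: near_eq_continuous_at cc.
move=> i; rewrite -(nbhs_singleton cc') => ic; have [d1 d2] := cd i ic.
have E : \forall s \near t, (phi i \o c) s = (phi i \o c') s.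
  by apply: filterS cc' => s /= ->.
split; first exact: near_eq_derivable d1.
apply: near_eq_continuous_at d2.
have := near_join E; apply: filterS => s Es.
by rewrite !derive1E; exact: near_eq_derive.
Qed.

(** Smoothness gives continuity in the point for each fixed direction. Expanding the direction in
    the standard basis gives joint continuity. *)
Lemma cvg_derive_dir (W : normedModType R) (T : Type) (F : set_system T)
    (FF : Filter F) (m : nat) (U : set 'rV[R]_m) (f : 'rV[R]_m -> W)
    (x z : T -> 'rV[R]_m) x0 z0 :
  smooth U f -> open U -> U x0 ->
  x s @[s --> F] --> x0 -> z s @[s --> F] --> z0 ->
  'D_(z s) f (x s) @[s --> F] --> 'D_z0 f x0.
Proof.
move=> sf oU Ux xc zc.
have E y v : U y -> 'D_v f y = \sum_k v 0 k *: 'D_(delta_mx 0 k) f y.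
  move=> Uy; have fd := smooth_diff sf Uy.
  rewrite deriveE// {1}[v]row_sum_delta linear_sum; apply: eq_bigr => k _.
  by rewrite linearZ -deriveE.
rewrite E//.
apply: (@cvg_trans _ ((fun s => \sum_k z s 0 k *: 'D_(delta_mx 0 k) f (x s)) @ F)).
  apply: near_eq_cvg; near=> s; rewrite -E//.
  by near: s; apply: xc; exact: open_nbhs_nbhs.
apply: cvg_big => [|k _]; first exact: add_continuous.
apply: cvgZ; first exact: cvg_coord.
exact: (cvg_comp _ _ xc (smooth_derive_continuous sf Ux)).
Unshelve. all: by end_near. Qed.

Lemma open_overlap i j : open (phi i @` (dom i `&` dom j)).
Proof.
rewrite openE => _ [p [ip jp] <-]; rewrite /interior.
have H1 : \forall x \near phi i p, (phi i @` dom i) x by exact: near_image.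
have H2 : \forall x \near phi i p, dom j (psi i x).
  by apply: (psi_continuous ip); rewrite phiK//; exact: near_dom.
near=> x.
have [q iq qx] : (phi i @` dom i) x by near: x.
have jx : dom j (psi i x) by near: x.
by exists q => //; split => //; rewrite -(phiK iq) qx.
Unshelve. all: by end_near. Qed.

(** One chart suffices: in another chart the derivative of the curve is the derivative of the
    transition map applied to it, which is jointly continuous by [cvg_derive_dir]. *)
Lemma C1_at_chart i c t : dom i (c t) ->
  (\forall s \near t, {for s, continuous c} /\ derivable (phi i \o c) s 1) ->
  {for t, continuous (derive1 (phi i \o c))} -> C1_at c t.
Proof.
move=> ic cd zc.
pose Q s := {for s, continuous c} /\ derivable (phi i \o c) s 1.
have [cc cdt] : Q t by exact: (@nbhs_singleton _ t Q).
split; [exact: cc|move=> j jc].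
have D s : {for s, continuous c} -> derivable (phi i \o c) s 1 ->
    dom i (c s) -> dom j (c s) ->
    is_derive s 1 (phi j \o c)
      ('D_(derive1 (phi i \o c) s) (phi j \o psi i) (phi i (c s))).
  move=> cs ds is_ js; rewrite derive1E.
  exact: is_derive_change_chart (derivableP ds).
have [d1 d2] := D t cc cdt ic jc; split; first exact: d1.
rewrite /prop_for /continuous_at (derive1E (phi j \o c)) d2.
apply: (@cvg_trans _ ((fun s =>
  'D_(derive1 (phi i \o c) s) (phi j \o psi i) (phi i (c s))) @ t)).
  apply: near_eq_cvg; near=> s; rewrite (derive1E (phi j \o c)).
  have [cs ds] : Q s by near: s.
  have is_ : dom i (c s) by near: s; exact: near_curve_dom.
  have js : dom j (c s) by near: s; exact: near_curve_dom.
  by have [_ ->] := D s cs ds is_ js.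
have xc : phi i (c s) @[s --> t] --> phi i (c t).
  exact: (cvg_comp _ _ cc (phi_continuous ic)).
have xt : (phi i @` (dom i `&` dom j)) (phi i (c t)) by exists (c t).
exact: (@cvg_derive_dir _ _ _ (nbhs_filter t) _ _ _ _ _ _ _
  (@transition_smooth _ _ _ g i j) (@open_overlap i j) xt xc zc).
Unshelve. all: by end_near. Qed.

End Curves.

(** * Upper semicontinuity of the distance *)

Section PerturbedCurve.
Context {R : realType} {n : nat} {M : topologicalType}.
Variables (g : riemannian R n M) (c : R -> M) (i : chart g) (d : R).
Variables (eta deta : R -> R).
Hypotheses (cC1 : C1_curve g c) (d0 : 0 < d).
Hypothesis ci : forall t, `|t - 1| < d -> dom i (c t).
Hypothesis eta_derive : forall t : R, is_derive t 1 eta (deta t).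
Hypothesis deta_continuous : continuous deta.
Hypothesis eta0 : forall t : R, d / 2 <= `|t - 1| -> eta t = 0.
Implicit Types (t s : R) (w : 'rV[R]_n).

(* The curve c is moved near time 1 so as to change its endpoint c 1. The bump
   eta vanishes on both sides of 1, as curves are C^1 on the whole line. *)
Definition perturbed_chart w t := phi i (c t) + eta t *: w.

Definition perturbed w t :=
  if `|t - 1| < d then psi i (perturbed_chart w t) else c t.

Definition perturbed_derive w t := derive1 (phi i \o c) t + deta t *: w.

Lemma near_norm_lt (a e t : R) : `|t - a| < e -> \forall s \near t, `|s - a| < e.
Proof.
move=> te; suff : `|s - a| @[s --> t] --> `|t - a| by move=> /cvgr_lt; exact.
by apply: cvg_norm; apply: cvgB; [exact: cvg_id|exact: cvg_cst].
Qed.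

Lemma near_norm_gt (a e t : R) : e < `|t - a| -> \forall s \near t, e < `|s - a|.
Proof.
move=> te; suff : `|s - a| @[s --> t] --> `|t - a| by move=> /cvgr_gt; exact.
by apply: cvg_norm; apply: cvgB; [exact: cvg_id|exact: cvg_cst].
Qed.

(** For d/2 <= |t - 1| < d the two branches of [perturbed] agree, as eta vanishes there. This
    overlap is what makes the glued curve C^1. *)
Lemma perturbed_far w t : d / 2 <= `|t - 1| -> perturbed w t = c t.
Proof.
move=> td; rewrite /perturbed; case: ifPn => // tl.
by rewrite /perturbed_chart eta0// scale0r addr0 phiK//; exact: ci.
Qed.

Lemma is_derive_perturbed_chart w t : `|t - 1| < d ->
  is_derive t 1 (perturbed_chart w) (perturbed_derive w t).
Proof.
move=> td; have [cd _] := cC1.2 t i (ci td).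
rewrite /perturbed_derive derive1E.
apply: is_deriveD (derivableP cd) _.
apply: is_derive_mx => k l; rewrite mxE.
under eq_fun do rewrite mxE.
have H := is_deriveM (eta_derive t) (is_derive_cst (w k l : R^o) t 1).
by apply: (is_derive_eq H); rewrite scaler0 add0r /GRing.scale/= mulrC.
Qed.

(** Convergence is joint in time and displacement, so that compactness in time can later give a
    bound uniform in t. *)
Lemma cvg_perturbed_chart t w : `|t - 1| < d ->
  perturbed_chart x.2 x.1 @[x --> (t, w)] --> perturbed_chart w t.
Proof.
move=> td.
have t1 : x.1 @[x --> (t, w)] --> t by exact: cvg_fst.
have w2 : x.2 @[x --> (t, w)] --> w by exact: cvg_snd.
have pc : phi i (c s) @[s --> t] --> phi i (c t).
  exact: (cvg_comp _ _ (cC1.1 t) (phi_continuous (ci td))).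
have ec : eta s @[s --> t] --> eta t.
  have [ed _] := eta_derive t.
  by apply: differentiable_continuous; exact/derivable1_diffP.
apply: cvgD; first exact: (cvg_comp _ _ t1 pc).
by apply: cvgZ w2; exact: (cvg_comp _ _ t1 ec).
Qed.

Lemma cvg_perturbed_derive t w : `|t - 1| < d ->
  perturbed_derive x.2 x.1 @[x --> (t, w)] --> perturbed_derive w t.
Proof.
move=> td; have [_ zc] := cC1.2 t i (ci td).
have t1 : x.1 @[x --> (t, w)] --> t by exact: cvg_fst.
have w2 : x.2 @[x --> (t, w)] --> w by exact: cvg_snd.
apply: cvgD; first exact: (cvg_comp _ _ t1 zc).
by apply: cvgZ w2; exact: (cvg_comp _ _ t1 (@deta_continuous t)).
Qed.

Variable w : 'rV[R]_n.
Hypothesis w_image : forall t, `|t - 1| < d ->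
  (phi i @` dom i) (perturbed_chart w t).

Lemma perturbed_near t : `|t - 1| < d ->
  dom i (perturbed w t) /\ phi i (perturbed w t) = perturbed_chart w t.
Proof.
move=> td; rewrite /perturbed td; have [p ip <-] := w_image td.
by rewrite phiK.
Qed.

Lemma perturbed_chart_derive t : `|t - 1| < d ->
  is_derive t 1 (phi i \o perturbed w) (perturbed_derive w t).
Proof.
move=> td; apply: near_eq_is_derive (is_derive_perturbed_chart w td).
have := near_norm_lt td; apply: filterS => s sd.
by have [_ <-] := perturbed_near sd.
Qed.

(** For |t - 1| < d the curve is read in chart i; for |t - 1| >= d it coincides with c near t,
    because d/2 < d. *)
Lemma perturbed_C1 : C1_curve g (perturbed w).
Proof.
apply/C1_curve_at => t.
have [td|td] := ltP `|t - 1| d; last first.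
  have td' : d / 2 < `|t - 1|.
    by apply: lt_le_trans td; rewrite ltr_pdivrMr// ltr_pMr// ltr1n.
  have := (C1_curve_at g c).1 cC1 t; apply: C1_at_near.
  have := near_norm_gt td'; apply: filterS => s sd.
  by rewrite perturbed_far// ltW.
have [ic _] := perturbed_near td.
have cont s : `|s - 1| < d -> {for s, continuous (perturbed w)}.
  move=> sd; have [is_ es] := perturbed_near sd.
  apply: (@near_eq_continuous_at _ _ (psi i \o perturbed_chart w)).
    by have := near_norm_lt sd; apply: filterS => u ud; rewrite /perturbed ud.
  have pc : {for s, continuous (perturbed_chart w)}.
    apply: differentiable_continuous; apply/derivable1_diffP.
    by have [] := is_derive_perturbed_chart w sd.
  have sc : {for perturbed_chart w s, continuous (psi i)}.
    by rewrite -es; exact: psi_continuous.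
  exact: (cvg_comp _ _ pc sc).
apply: (C1_at_chart ic).
  have := near_norm_lt td; apply: filterS => s sd.
  by split; [exact: cont|have [] := perturbed_chart_derive sd].
apply: (@near_eq_continuous_at _ _ (perturbed_derive w)).
  have := near_norm_lt td; apply: filterS => s sd.
  by rewrite derive1E; have [_ ->] := perturbed_chart_derive sd.
have [_ zc] := cC1.2 t i (ci td); apply: cvgD; first exact: zc.
by apply: cvgZ; [exact: deta_continuous|exact: cvg_cst].
Qed.

Lemma perturbed_speed t : `|t - 1| < d ->
  tnorm g (perturbed w t) (velocity g (perturbed w) t) =
  Num.sqrt (bilin (metric i (perturbed_chart w t)) (perturbed_derive w t)
                  (perturbed_derive w t)).
Proof.
move=> td; have [ic ec] := perturbed_near td.
rewrite (speedE perturbed_C1 ic) ec derive1E.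
by have [_ ->] := perturbed_chart_derive td.
Qed.

End PerturbedCurve.

Section DistUpperSemicontinuous.
Context {R : realType} {n : nat} {M : topologicalType}.
Variable g : riemannian R n M.
Implicit Types (p q : M) (a : R).

Lemma length_le c c' (b : R) : C1_curve g c -> C1_curve g c' ->
  (forall t, 0 <= t <= 1 ->
    tnorm g (c' t) (velocity g c' t) <= tnorm g (c t) (velocity g c t) + b) ->
  length g c' <= length g c + b.
Proof.
move=> cC cC' le_b.
have ibd : lebesgue_measure.-integrable `[0, 1] (EFin \o (fun=> b)).
  by apply: integrable_continuous01 => x; exact: cvg_cst.
have bE : \int[@lebesgue_measure R]_(t in `[0, 1]) b = b.
  rewrite Rintegral_cst//=.
  rewrite lebesgue_measure_itv/= lte_fin ltr01 /=.
  by rewrite oppr0 addr0 mulr1.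
rewrite -[X in _ + X]bE.
rewrite /length -RintegralD//; last exact: integrable_speed.
apply: le_Rintegral; first exact: measurable_itv.
- exact: integrable_speed.
- apply: integrable_continuous01 => x.
  by apply: cvgD; [exact: speed_continuous|exact: cvg_cst].
- by move=> t /=; rewrite in_itv/= => /le_b.
Qed.

(** A curve from p to q of length less than a is bent near its end so as to reach q'. For q' close
    to q its speed, hence its length, grows by at most half of the available slack. *)
Lemma dist_usc p q a : (dist g p q < a%:E)%E ->
  \forall q' \near q, (dist g p q' < a%:E)%E.
Proof.
move=> /ereal_inf_lt[_ [c [cC c0 c1] <-]]; rewrite lte_fin => ca.
have ib := chart_at_dom g q; set i := chart_at g q in ib.
(* The bound d <= 1 keeps time 0 outside of the support of the bump, so the starting point p stays
   fixed. *)
have [d /andP[d0 d1] ci] : exists2 d : R, 0 < d <= 1 &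
    forall t, `|t - 1| < d -> dom i (c t).
  have : \forall t \near (1 : R), dom i (c t).
    by apply: near_curve_dom; [exact: cC.1|rewrite c1].
  move=> /nbhs_ballP[e /= e0 ce]; exists (Order.min e 1).
    by rewrite lt_min e0 ltr01 ge_min lexx orbT.
  by move=> t; rewrite lt_min => /andP[te _]; apply: ce; rewrite /ball/= distrC.
have d2 : 0 < d / 2 by rewrite divr_gt0.
have d2d : d / 2 < d by rewrite ltr_pdivrMr// ltr_pMr// ltr1n.
have [eta [deta [etad detac eta1 eta0]]] := C1_bump 1 d2.
pose b := (a - length g c) / 2.
have b0 : 0 < b by rewrite divr_gt0// subr_gt0.
pose pc := perturbed_chart c i eta.
pose pd := perturbed_derive c i deta.
pose speed t := tnorm g (c t) (velocity g c t).
(* The displaced point stays in the image of the chart, and the speed at time t grows by at most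
   b. *)
pose good (w : 'rV[R]_n) (t : R) := (phi i @` dom i) (pc w t) /\
  Num.sqrt (bilin (metric i (pc w t)) (pd w t) (pd w t)) <= speed t + b.
have good0 (t : R) : 1 - d / 2 <= t <= 1 + d / 2 ->
    \forall x \near (t, 0 : 'rV[R]_n), good x.2 x.1.
  move=> tI.
  have td : `|t - 1| < d.
    by apply: le_lt_trans d2d; rewrite ler_norml; apply/andP; split; lra.
  have ic := ci t td.
  have pc0 : pc 0 t = phi i (c t) by rewrite /pc /perturbed_chart scaler0 addr0.
  have pd0 : pd 0 t = derive1 (phi i \o c) t.
    by rewrite /pd /perturbed_derive scaler0 addr0.
  have H1 : pc x.2 x.1 @[x --> (t, 0 : 'rV[R]_n)] --> phi i (c t).
    by rewrite -pc0; exact: (cvg_perturbed_chart cC ci etad td).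
  have H2 : pd x.2 x.1 @[x --> (t, 0 : 'rV[R]_n)] --> derive1 (phi i \o c) t.
    by rewrite -pd0; exact: (cvg_perturbed_derive cC ci detac td).
  have H3 := @cvg_speed _ _ _ g _ _ (nbhs_filter (t, 0 : 'rV[R]_n)) _ _ _ _ _ ic H1 H2.
  rewrite -(speedE cC ic) in H3.
  have H4 : speed x.1 @[x --> (t, 0 : 'rV[R]_n)] --> speed t.
    by apply: (cvg_comp _ _ cvg_fst); exact: speed_continuous.
  have near_img := H1 _ (near_image ic).
  have near_sp : \forall x \near (t, 0 : 'rV[R]_n),
      Num.sqrt (bilin (metric i (pc x.2 x.1)) (pd x.2 x.1) (pd x.2 x.1)) -
      speed x.1 < b.
    have H5 := cvgB H3 H4.
    have H6 : tnorm g (c t) (velocity g c t) - speed t < b by rewrite subrr.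
    exact: (cvgr_lt _ (H5 (nbhs_filter _)) _ H6).
  near=> x; split; first by near: x.
  by rewrite -lerBlDl ltW//; near: x.
(* Compactness of the time interval yields one neighbourhood of the displacement 0 that serves all
   t. *)
have {}good0 : \forall w \near (0 : 'rV[R]_n),
    `[1 - d / 2, 1 + d / 2]%classic `<=` good w.
  have /compact_near_coveringP cov := @segment_compact R (1 - d / 2) (1 + d / 2).
  apply: (cov _ _ good (nbhs_filter (0 : 'rV[R]_n))) => t /=.
  by rewrite in_itv/=; exact: good0.
have qi : phi i q' - phi i q @[q' --> q] --> (0 : 'rV[R]_n).
  rewrite -(subrr (phi i q)); apply: cvgB; last exact: cvg_cst.
  exact: phi_continuous.
have near_good : \forall q' \near q,
    `[1 - d / 2, 1 + d / 2]%classic `<=` good (phi i q' - phi i q).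
  exact: (qi _ good0).
near=> q'.
(* As eta is 1 at time 1, this displacement moves the end of the curve exactly to q'. *)
pose w := phi i q' - phi i q.
have iq' : dom i q' by near: q'; exact: near_dom.
have gw : `[1 - d / 2, 1 + d / 2]%classic `<=` good w by rewrite /w; near: q'.
have wI t : `|t - 1| < d -> (phi i @` dom i) (perturbed_chart c i eta w t).
  move=> td; have [tI|tO] := leP `|t - 1| (d / 2).
    have [] := gw t; rewrite //= in_itv/=.
    by move: tI; rewrite ler_norml => /andP[? ?]; apply/andP; split; lra.
  rewrite /perturbed_chart eta0 ?scale0r ?addr0 ?ltW//.
  by exists (c t) => //; exact: ci.
pose c' := perturbed c i d eta w.
have C' : C1_curve g c' by exact: (perturbed_C1 cC d0 ci etad detac eta0 wI).
have far t : d / 2 <= `|t - 1| -> c' t = c t by exact: perturbed_far.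
have c'0 : c' 0 = p.
  rewrite far// sub0r normrN normr1; apply: le_trans (_ : d <= _) => //.
  exact: ltW.
have c'1 : c' 1 = q'.
  rewrite /c' /perturbed subrr normr0 d0 /perturbed_chart eta1 scale1r c1.
  by rewrite addrC subrK phiK.
have le : length g c' <= length g c + b.
  apply: length_le => // t _; have [tI|tO] := leP `|t - 1| (d / 2).
    rewrite (perturbed_speed cC d0 ci etad detac eta0 wI (le_lt_trans tI d2d)).
    have [] := gw t; rewrite //= in_itv/=.
    by move: tI; rewrite ler_norml => /andP[? ?]; apply/andP; split; lra.
  suff [-> ->] : c' t = c t /\ velocity g c' t = velocity g c t.
    by rewrite lerDl ltW.
  have E := far _ (ltW tO); split => //.
  (* Equal velocities require the curves to agree around t, which the strict inequality d/2 < |t -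
     1| provides. *)
  rewrite /velocity E !derive1E; apply: near_eq_derive.
  have := near_norm_gt tO; apply: filterS => s /ltW sd.
  by rewrite /= far.
apply: le_lt_trans (_ : (length g c + b)%:E < _)%E; last first.
  by rewrite lte_fin -ltrBrDl ltr_pdivrMr// ltr_pMr ?ltr1n// subr_gt0.
apply: le_trans (_ : (length g c')%:E <= _)%E; last by rewrite lee_fin.
by apply: ereal_inf_lbound; exists c'.
Unshelve. all: by end_near. Qed.

Lemma dist_ge0 p q : (0 <= dist g p q)%E.
Proof.
apply: le_ereal_inf_tmp => _ [c _ <-]; rewrite lee_fin; apply: Rintegral_ge0 => t _.
exact: sqrtr_ge0.
Qed.

End DistUpperSemicontinuous.

(** * Measurability of the logarithm *)

(** Boxes with rational corners form a countable basis of the topology, indexed by a [countType]. *)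
Definition rat_box (R : realType) (n : nat) (k : 'rV[rat]_n * 'rV[rat]_n) :
    set 'rV[R]_n :=
  [set v | forall j, ratr (k.1 0 j) < v 0 j < ratr (k.2 0 j)].

Lemma open_rat_box (R : realType) (n : nat) (k : 'rV[rat]_n * 'rV[rat]_n) :
  open (@rat_box R n k).
Proof.
rewrite openE => v kv; exists (fun i j => `]ratr (k.1 0 j), ratr (k.2 0 j)[%classic).
  move=> i j; rewrite ord1; apply: open_nbhs_nbhs; split.
    exact: interval_open.
  by rewrite /= in_itv/=; exact: kv.
by move=> u /= kuv j; have := kuv 0 j; rewrite in_itv.
Qed.

Lemma rat_box_basis (R : realType) (n : nat) (U : set 'rV[R]_n) v :
  nbhs v U -> exists k, @rat_box R n k v /\ @rat_box R n k `<=` U.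
Proof.
move=> [P Pv PU].
have /choice[ab abP] (j : 'I_n) : exists ab : rat * rat,
    ratr ab.1 < v 0 j < ratr ab.2 /\
    forall x, ratr ab.1 < x < ratr ab.2 -> P 0 j x.
  have /nbhs_ballP[e /= e0 eP] := Pv 0 j.
  have /rat_in_itvoo[a] : v 0 j - e < v 0 j by rewrite ltrBlDr ltrDl.
  have /rat_in_itvoo[b] : v 0 j < v 0 j + e by rewrite ltrDl.
  rewrite !in_itv/= => /andP[vb be] /andP[ea av].
  exists (a, b) => /=; rewrite av vb; split => // x /andP[ax xb].
  apply: eP; rewrite /ball/= ltr_distlC; apply/andP; split.
    exact: lt_trans ax.
  exact: lt_trans be.
exists (\row_j (ab j).1, \row_j (ab j).2); split=> [j|u ku].
  by rewrite !mxE; have [] := abP j.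
apply: PU => i j; rewrite ord1; apply: (abP j).2.
by have := ku j; rewrite !mxE.
Qed.

(** The union is reindexed by natural numbers through [pickle]; numbers that code no index
    contribute the empty set. *)
Lemma bigcup_countType_measurable d (T : measurableType d) (I : countType)
    (A : I -> set T) (D : set I) :
  (forall k, D k -> measurable (A k)) -> measurable (\bigcup_(k in D) A k).
Proof.
move=> mA.
rewrite (_ : \bigcup_(k in D) A k = \bigcup_m
    (if unpickle m is Some k then [set x | D k /\ A k x] else set0)); last first.
  apply/seteqP; split=> [x [k Dk Ax]|x [m _]].
    by exists (pickle k) => //; rewrite pickleK.
  by case: unpickle => // k [Dk Ax]; exists k.
apply: bigcup_measurable => m _; case: unpickle => // k.
have [Dk|nDk] := pselect (D k).
  by rewrite (_ : [set x | _] = A k); [exact: mA|apply/seteqP; split => x // []].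
by rewrite (_ : [set x | _] = set0) //; apply/seteqP; split => x // [].
Qed.

Section LogMeasurable.
Context {R : realType} {n : nat} {M : topologicalType}.
Variable g : riemannian R n M.
Implicit Types (p q : M) (u v w : 'rV[R]_n).

Lemma tnorm_continuous p : continuous (tnorm g p).
Proof.
move=> v; have idv : u @[u --> v] --> v by exact: cvg_id.
have cG := @cst_continuous 'rV[R]_n _
    (metric (chart_at g p) (phi (chart_at g p) p)) v.
have H := @cvg_bilin _ _ _ (nbhs_filter v) _ _ _ _ _ _ _ cG idv idv.
exact: (cvg_comp _ _ H (@sqrt_continuous R _)).
Qed.

(** The inverse is smooth when read in charts; composing with [phi i] gives continuity on M
    itself. *)
Lemma diffeo_inverse (U : set 'rV[R]_n) (f : 'rV[R]_n -> M) : diffeo_on g U f ->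
  exists2 h : M -> 'rV[R]_n, forall v, U v -> h (f v) = v &
    forall v, U v -> {for f v, continuous h}.
Proof.
move=> [oU _ _ [h hK hs]]; exists h => // v Uv.
have ic := chart_at_dom g (f v); set i := chart_at g (f v) in ic.
have hc : {for phi i (f v), continuous (h \o psi i)}.
  by have := hs i 0%N; apply; exists (f v); [split => //; exists v|].
apply: (@near_eq_continuous_at _ _ ((h \o psi i) \o phi i)).
  by apply: filterS (near_dom ic) => q iq; rewrite /= phiK.
exact: (cvg_comp _ _ (phi_continuous ic) hc).
Qed.

Lemma open_image_diffeo (U B : set 'rV[R]_n) (f : 'rV[R]_n -> M) :
  diffeo_on g U f -> open B -> B `<=` U -> open (f @` B).
Proof.
move=> fU oB BU; have [h hK hc] := diffeo_inverse fU.
have [ofU _ _ _] := fU.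
rewrite openE => _ [v Bv <-]; rewrite /interior.
have H1 : \forall q \near f v, (f @` U) q.
  by apply: open_nbhs_nbhs; split => //; exists v => //; exact: BU.
have H2 : \forall q \near f v, B (h q).
  apply: (hc v (BU _ Bv)); rewrite hK; last exact: BU.
  exact: open_nbhs_nbhs.
near=> q; have [u Uu uq] : (f @` U) q by near: q.
exists u => //; rewrite -(hK u Uu) uq; by near: q.
Unshelve. all: by end_near. Qed.

Section RandomPoint.
Context {d : measure_display} {Omega : measurableType d}.
Variables (Z : Omega -> M) (p : M).
Hypothesis mZ : random_point Z.

(** [is_log] may hold of several vectors for one point; uniqueness is dealt with in
    [measurable_rlog]. *)
Definition log_in (B : set 'rV[R]_n) : set Omega :=
  [set y | exists2 v, B v & is_log g p (Z y) v].

(** On U the only candidate is h (Z y), so the event says that Z y lies in the image of B and that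
    its distance to p equals |h (Z y)|. The two strict inequalities between these numbers are
    removed separately, the distance being only upper semicontinuous. *)
Lemma measurable_log_in_diffeo (U B : set 'rV[R]_n) :
  open U -> diffeo_on g U (rexp g p) -> open B -> B `<=` U ->
  measurable (log_in B).
Proof.
move=> oU fU oB BU; have [h hK hc] := diffeo_inverse fU.
set f := rexp g p in fU hK hc.
have oQ := open_image_diffeo fU oB BU.
pose A := Z @^-1` (f @` B).
pose lo := [set y | A y /\ (dist g p (Z y) < (tnorm g p (h (Z y)))%:E)%E].
(* The condition |h (Z y)| < dist is a countable union over rational r of |h (Z y)| < r <= dist,
   each a difference of preimages of open sets. *)
pose hi (r : rat) := [set y | A y /\ tnorm g p (h (Z y)) < ratr r] `\`
                     Z @^-1` [set q | (dist g p q < (ratr r)%:E)%E].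
have -> : log_in B = A `\` (lo `|` \bigcup_r hi r).
  apply/seteqP; split=> [y [v Bv [vq vd _]]|y [[v Bv vq] nlo]].
    have hv : h (Z y) = v by rewrite -vq hK//; exact: BU.
    split; first by exists v.
    case=> [[_]|[r _ [[_ vr] ndr]]]; first by rewrite hv -vd ltxx.
    by apply: ndr; rewrite /= -vd lte_fin; rewrite hv in vr.
  have hv : h (Z y) = v by rewrite -vq hK//; exact: BU.
  have Ao : A y by exists v.
  exists v => //; split => //; last by exists U; split => //; exact: BU.
  apply/eqP; rewrite eq_le; apply/andP; split.
    by rewrite leNgt; apply/negP => dv; apply: nlo; left; split => //; rewrite hv.
  rewrite leNgt; apply/negP => dv; apply: nlo; right.
  have [r vr rd] : exists2 r : rat, tnorm g p v < ratr r &
      ((ratr r)%:E <= dist g p (Z y))%E.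
    move: dv; case: (dist g p (Z y)) => [x||]//=.
      rewrite lte_fin => /rat_in_itvoo[r]; rewrite in_itv/= => /andP[vr rx].
      by exists r; rewrite // lee_fin ltW.
    move=> _; have /rat_in_itvoo[r] : tnorm g p v < tnorm g p v + 1.
      by rewrite ltrDl.
    by rewrite in_itv/= => /andP[vr _]; exists r; rewrite // leey.
  by exists r => //; split; [split; rewrite ?hv|apply/negP; rewrite -leNgt].
have odist a : open [set q | (dist g p q < a%:E)%E].
  by rewrite openE => q qa; exact: dist_usc.
have htn v : B v -> tnorm g p (h q) @[q --> f v] --> tnorm g p (h (f v)).
  move=> Bv; exact: (cvg_comp _ _ (hc v (BU _ Bv)) (@tnorm_continuous p _)).
apply: measurableD; first exact: mZ.
apply: measurableU.
  apply: (mZ (U := [set q | (f @` B) q /\ (dist g p q < (tnorm g p (h q))%:E)%E])).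
  rewrite openE => _ [[v Bv <-] dv]; rewrite /interior.
  (* With a strictly between the two sides, the inequality persists near f v: dist < a by
     semicontinuity and a < |h| by continuity. *)
  have [a da av] : exists2 a : R, (dist g p (f v) < a%:E)%E &
      a < tnorm g p (h (f v)).
    move: dv; have := dist_ge0 g p (f v).
    case: (dist g p (f v)) => [x||]//= _; rewrite lte_fin => xv.
    by exists ((x + tnorm g p (h (f v))) / 2); rewrite ?lte_fin midf_lt.
  have H1 := dist_usc da.
  have H2 : \forall q \near f v, a < tnorm g p (h q).
    exact: (cvgr_gt _ (htn v Bv) _ av).
  have H3 : \forall q \near f v, (f @` B) q.
    by apply: open_nbhs_nbhs; split => //; exists v.
  near=> q; split; first by near: q.
  apply: (@lt_trans _ _ a%:E); first by near: q.
  by rewrite lte_fin; near: q.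
apply: bigcup_countType_measurable => r _; apply: measurableD; last exact: mZ.
apply: (mZ (U := [set q | (f @` B) q /\ tnorm g p (h q) < ratr r])).
rewrite openE => _ [[v Bv <-] vr]; rewrite /interior.
have H2 : \forall q \near f v, tnorm g p (h q) < ratr r.
  exact: (cvgr_lt _ (htn v Bv) _ vr).
have H3 : \forall q \near f v, (f @` B) q.
  by apply: open_nbhs_nbhs; split => //; exists v.
near=> q; split; by near: q.
Unshelve. all: by end_near. Qed.

(** Each logarithm has, by definition, a neighbourhood on which exp is a diffeomorphism, so the
    rational boxes inside B and inside such neighbourhoods cover all cases. *)
Lemma measurable_log_in (B : set 'rV[R]_n) : open B -> measurable (log_in B).
Proof.
move=> oB.
pose D := [set k | @rat_box R n k `<=` B /\ exists U, [/\ open U,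
  diffeo_on g U (rexp g p) & @rat_box R n k `<=` U]].
have -> : log_in B = \bigcup_(k in D) log_in (@rat_box R n k).
  apply/seteqP; split=> [y [v Bv vl]|y [k [kB _] [v kv vl]]]; last first.
    by exists v => //; exact: kB.
  have [_ _ [U [oU Uv fU]]] := vl.
  have [|k [kv kBU]] := @rat_box_basis R n (B `&` U) v.
    by apply: open_nbhs_nbhs; split => //; exact: openI.
  exists k; last by exists v.
  split; first by move=> u /kBU[].
  by exists U; split => // u /kBU[].
apply: bigcup_countType_measurable => k [_ [U [oU fU kU]]].
exact: (measurable_log_in_diffeo oU fU (@open_rat_box R n k) kU).
Qed.

Lemma measurable_rlog (B : set 'rV[R]_n) : open B ->
  measurable [set y | B (rlog g p (Z y))].
Proof.
move=> oB.
(* Two distinct logarithms are separated by disjoint rational boxes, so non-uniqueness is a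
   countable union of measurable events. *)
pose disj (k : ('rV[rat]_n * 'rV[rat]_n) * ('rV[rat]_n * 'rV[rat]_n)) :=
  @rat_box R n k.1 `&` @rat_box R n k.2 = set0.
pose multi := \bigcup_(k in disj)
  (log_in (@rat_box R n k.1) `&` log_in (@rat_box R n k.2)).
have mmulti : measurable multi.
  apply: bigcup_countType_measurable => k _.
  by apply: measurableI; apply: measurable_log_in; exact: open_rat_box.
have multiP y : multi y <->
    exists v w, [/\ v != w, is_log g p (Z y) v & is_log g p (Z y) w].
  split=> [[k dk [[v kv vl] [w kw wl]]]|[v [w [vw vl wl]]]].
    exists v, w; split => //; apply/eqP => vw.
    have : (@rat_box R n k.1 `&` @rat_box R n k.2) v by split; rewrite // vw.
    by rewrite dk.
  have := @norm_hausdorff R 'rV[R]_n; rewrite open_hausdorff.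
  move=> /(_ v w vw)[[X Y] /= [vX wY] [oX oY XY]].
  have [k [kv kX]] : exists k, @rat_box R n k v /\ @rat_box R n k `<=` X.
    by apply: rat_box_basis; apply: open_nbhs_nbhs; split => //; rewrite inE in vX.
  have [l [lw lY]] : exists k, @rat_box R n k w /\ @rat_box R n k `<=` Y.
    by apply: rat_box_basis; apply: open_nbhs_nbhs; split => //; rewrite inE in wY.
  exists (k, l); last by split; [exists v|exists w].
  apply/seteqP; split => // x [/kX Xx /lY Yx].
  by have : (X `&` Y) x by []; rewrite (eqP XY).
have uniq y v : ~ multi y -> is_log g p (Z y) v -> rlog g p (Z y) = v.
  move=> no vl; apply: xget_unique.
    split => // w wl; apply/eqP; apply/negPn/negP => wv.
    by apply: no; apply/multiP; exists w, v.
  by move=> w [wl +]; move=> /(_ v vl).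
have none y : multi y \/ ~ log_in setT y -> rlog g p (Z y) = 0.
  move=> H; apply: xgetPN => v [vl vu]; case: H => [/multiP[u [w [uw ul wl]]]|].
    by move: uw; rewrite (vu u ul) (vu w wl) eqxx.
  by apply; exists v.
have mT : measurable (log_in setT) by apply: measurable_log_in; exact: openT.
(* Without a unique logarithm [rlog] takes its default value 0, so those outcomes count exactly when
   0 lies in B. *)
have -> : [set y | B (rlog g p (Z y))] =
    (log_in B `\` multi) `|`
    (if pselect (B 0) then multi `|` ~` (log_in setT) else set0).
  apply/seteqP; split=> [y Bo|y [[[v Bv vl] no]|]]; last 2 first.
  - by rewrite /= (uniq _ _ no vl).
  - by case: pselect => // B0 no; rewrite /= none.
  have [mo|no] := pselect (multi y).
    right; case: pselect => [B0|]; first by left.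
    by apply; rewrite /= none// in Bo; left.
  have [[v _ vl]|nl] := pselect (log_in setT y).
    by left; split => //; exists v => //; rewrite -(uniq _ _ no vl).
  right; case: pselect => [B0|]; first by right.
  by apply; rewrite /= none// in Bo; right.
apply: measurableU; first by apply: measurableD => //; exact: measurable_log_in.
case: (pselect (B 0)) => B0; last exact: measurable0.
by apply: measurableU => //; exact: measurableC.
Qed.

End RandomPoint.
End LogMeasurable.

(** * Covariance *)

Lemma measurable_fun_open d (T : measurableType d) (R : realType) (f : T -> R) :
  (forall B : set R, open B -> measurable (f @^-1` B)) -> measurable_fun setT f.
Proof.
move=> fB; apply: (measurability _ (RGenOpens.measurableE R)) => //.
by move=> _ [_ [a [b ->]] <-]; rewrite setTI; apply: fB; exact: interval_open.
Qed.

Section Covariance.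
Context {R : realType} {n : nat} {M : topologicalType}.
Variable g : riemannian R n M.
Implicit Types (E : 'M[R]_n) (u v : 'rV[R]_n).

(** Orthonormality reads E G E^T = 1. For square matrices this one-sided inverse is two-sided, which
    is the completeness of the basis. *)
Lemma inner_parseval p E u v : orthonormal_basis g p E ->
  inner g p u v = \sum_a inner g p u (row a E) * inner g p v (row a E).
Proof.
move=> EP; set G := metric (chart_at g p) (phi (chart_at g p) p).
have innerE w a : inner g p w (row a E) = (w *m G *m E^T) 0 a.
  rewrite /inner /bilin -/G !mxE; apply: eq_bigr => k _.
  by rewrite !mxE.
have EGE : E *m G *m E^T = 1%:M.
  apply/matrixP => a b; rewrite [RHS]mxE -EP innerE -!row_mul.
  by rewrite [RHS]mxE.
have GE : E^T *m (E *m G) = 1%:M by exact: mulmx1C.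
under eq_bigr do rewrite !innerE.
have -> : \sum_a (u *m G *m E^T) 0 a * (v *m G *m E^T) 0 a =
    ((u *m G *m E^T) *m (v *m G *m E^T)^T) 0 0.
  by rewrite [RHS]mxE; apply: eq_bigr => a _; congr (_ * _); rewrite [RHS]mxE.
rewrite !trmx_mul trmxK Defs.metric_sym; last exact: chart_at_dom.
rewrite -/G /inner /bilin -/G; congr ((_ : 'M[R]_(_, _)) 0 0).
by rewrite -!mulmxA (mulmxA E) (mulmxA E^T) GE mul1mx.
Qed.

Lemma measurable_dist d (Omega : measurableType d) (Z : Omega -> M) p :
  random_point Z -> measurable_fun setT (fun o => dist g p (Z o)).
Proof.
move=> mZ; apply: (measurability _ (ErealGenInftyO.measurableE R)) => //.
move=> _ [_ [r ->] <-]; rewrite setTI.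
have -> : (fun o => dist g p (Z o)) @^-1` `]-oo, r%:E[%classic =
    Z @^-1` [set q | (dist g p q < r%:E)%E].
  by apply/seteqP; split => y /=; rewrite in_itv.
by apply: mZ; rewrite openE => q qr; exact: dist_usc.
Qed.

Lemma inner_rlog_le p q :
  ((inner g p (rlog g p q) (rlog g p q))%:E <= dist g p q ^+ 2)%E.
Proof.
rewrite /rlog; case: xgetP => [v _ [[_ vd _] _]|_].
  by rewrite -vd -EFin_expe lee_fin sqr_sqrtr// inner_ge0.
by rewrite /inner bilin0l expe2 mule_ge0// dist_ge0.
Qed.

(** * Measurability and square integrability of the logarithm *)

Section Integrability.
Context {d : measure_display} {Omega : measurableType d}.
Variables (P : probability Omega R) (Z : Omega -> M) (p p0 : M) (r : R).
Hypotheses (mZ : random_point Z) (pmean : unique_frechet_mean g P Z p).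
Hypothesis Zball : in_geodesic_ball g P Z p0 r.

Let log o := rlog g p (Z o).

Lemma measurable_comp_rlog (f : 'rV[R]_n -> R) : continuous f ->
  measurable_fun setT (f \o log).
Proof.
move=> fc; apply: measurable_fun_open => B oB.
have ofB : open (f @^-1` B) by apply: open_comp => // x _; exact: fc.
exact: (@measurable_rlog _ _ _ g _ _ Z p mZ _ ofB).
Qed.

(** The minimum is at most the value at the centre p0 of the ball, which is at most r^2. *)
Lemma frechet_lty : (frechet g P Z p < +oo)%E.
Proof.
have := pmean.1 p0; move=> /le_lt_trans; apply.
apply: (@le_lt_trans _ _ (\int[P]_o (r ^+ 2)%:E)%E); last first.
  rewrite integral_cst//.
  rewrite [X in (_ * X)%E](_ : _ = 1%E); last exact: probability_setT.
  by rewrite mule1 ltry.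
apply: ae_ge0_le_integral => //.
- by move=> o _; rewrite expe2 mule_ge0// dist_ge0.
- under eq_fun do rewrite expe2.
  by apply: emeasurable_funM; exact: measurable_dist.
- by move=> o _; rewrite lee_fin sqr_ge0.
case: Zball => N [mN N0 NS]; exists N; split => //.
apply: subset_trans NS => o /= + H; apply => _.
have := dist_ge0 g p0 (Z o); move: H; case: (dist g p0 (Z o)) => //= x.
rewrite !lee_fin lte_fin => xr x0; rewrite -expr2.
by rewrite ler_pXn2r// ?nnegrE// ?(ltW xr)// (le_trans x0 (ltW xr)).
Qed.

Lemma integrable_inner_rlog :
  P.-integrable setT (EFin \o (fun o => inner g p (log o) (log o))).
Proof.
have m : measurable_fun setT (fun o => inner g p (log o) (log o)).
  apply: (@measurable_comp_rlog (fun v => inner g p v v)) => v.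
  have idv : u @[u --> v] --> v by exact: cvg_id.
  have cG := @cst_continuous 'rV[R]_n _
    (metric (chart_at g p) (phi (chart_at g p) p)) v.
  exact: (@cvg_bilin _ _ _ (nbhs_filter v) _ _ _ _ _ _ _ cG idv idv).
apply/integrableP; split; first exact/measurable_EFinP.
apply: le_lt_trans frechet_lty; apply: ge0_le_integral => //.
- by apply: measurableT_comp => //; exact/measurable_EFinP.
- under eq_fun do rewrite expe2.
  by apply: emeasurable_funM; exact: measurable_dist.
- move=> o _; rewrite gee0_abs ?lee_fin ?inner_ge0//; exact: inner_rlog_le.
Qed.

Variables (c : R -> M) (a s : R) (u : 'rV[R]_n).
Hypothesis cC1 : C1_curve g c.

(** By [transport_mx] the function is continuous in the logarithm on the closed subspace cut out by
    B, and 0 on its open complement. *)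
Lemma measurable_transport_rlog :
  measurable_fun setT (fun o => inner g (c s) (transport g c a s (log o)) u).
Proof.
have [A [B AB]] := transport_mx cC1 a s.
have -> : (fun o => inner g (c s) (transport g c a s (log o)) u) =
    (fun o => if log o *m B == 0 then inner g (c s) (log o *m A) u else 0).
  by apply/funext => o; rewrite AB; case: ifP; rewrite // /inner bilin0l.
have cmul (C : 'M[R]_n) : continuous (fun v : 'rV[R]_n => v *m C).
  move=> v; have idv : u @[u --> v] --> v by exact: cvg_id.
  have cC := @cst_continuous 'rV[R]_n _ C v.
  exact: (@cvg_mulmx _ _ _ (nbhs_filter v) _ _ _ _ _ _ _ idv cC).
apply: measurable_fun_ifT; last exact: measurable_cst.
  apply: (measurable_fun_bool true); rewrite setTI.
  rewrite (_ : _ @^-1` _ = ~` [set o | (log o *m B != 0)]); last first.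
    apply/seteqP; split => o /=; first by move=> ->.
    by move/negP; rewrite negbK => /eqP ->; rewrite eqxx.
  apply: measurableC.
  have o0 : open [set w : 'rV[R]_n | w != 0].
    rewrite (_ : [set w | _] = ~` [set 0]).
      apply: closed_openC; apply: accessible_closed_set1.
      by apply: hausdorff_accessible; exact: norm_hausdorff.
    by apply/seteqP; split => w /= /eqP.
  have oB : open ((fun v => v *m B) @^-1` [set w | w != 0]).
    by apply: open_comp => [x _|]; [exact: cmul|exact: o0].
  exact: (@measurable_rlog _ _ _ g _ _ Z p mZ _ oB).
apply: (@measurable_comp_rlog (fun v => inner g (c s) (v *m A) u)) => v.
have cG := @cst_continuous 'rV[R]_n _
  (metric (chart_at g (c s)) (phi (chart_at g (c s)) (c s))) v.
have cu := @cst_continuous 'rV[R]_n _ u v.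
exact: (@cvg_bilin _ _ _ (nbhs_filter v) _ _ _ _ _ _ _ cG (cmul A v) cu).
Qed.

End Integrability.
End Covariance.

Lemma Rintegral_sum d (T : measurableType d) (R : realType)
    (mu : {measure set T -> \bar R}) (I : Type) (s : seq I) (f : I -> T -> R) :
  (forall i, mu.-integrable setT (EFin \o f i)) ->
  \int[mu]_x (\sum_(i <- s) f i x) = \sum_(i <- s) \int[mu]_x f i x.
Proof.
move=> fi.
(* Integrability of the partial sums is carried through the induction, since additivity of the
   integral requires it. *)
suff [] : mu.-integrable setT (EFin \o (fun x => \sum_(i <- s) f i x)) /\
  \int[mu]_x (\sum_(i <- s) f i x) = \sum_(i <- s) \int[mu]_x f i x by [].
elim: s => [|i s [ints IH]].
  split.
    rewrite (_ : _ \o _ = cst 0%E); first exact: integrable0.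
    by apply/funext => x /=; rewrite big_nil.
  under eq_Rintegral do rewrite big_nil.
  by rewrite big_nil /Rintegral integral0.
rewrite big_cons -IH -RintegralD//; split.
  rewrite (_ : _ \o _ = (EFin \o f i) \+
    (EFin \o (fun x => (\sum_(i <- s) f i x)%R)))%E.
    exact: integrableD.
  by apply/funext => x /=; rewrite big_cons EFinD.
by apply: eq_Rintegral => x _; rewrite big_cons.
Qed.

(** * The covariance as an expected inner product *)

Section CovarianceFormula.
Context {R : realType} {n : nat} {M : topologicalType}.
Variable g : riemannian R n M.
Context {d : measure_display} {Omega : measurableType d}.
Variables (P : probability Omega R) (X Y : Omega -> M) (pX pY : M) (rX rY : R).
Variables (c : R -> M) (t : R) (E : 'M[R]_n).
Hypotheses (cC1 : C1_curve g c) (mX : random_point X) (mY : random_point Y).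
Hypotheses (meanX : unique_frechet_mean g P X (c 0)).
Hypotheses (meanY : unique_frechet_mean g P Y (c 1)).
Hypotheses (ballX : in_geodesic_ball g P X pX rX).
Hypotheses (ballY : in_geodesic_ball g P Y pY rY).
Hypothesis EP : orthonormal_basis g (c t) E.

Lemma CovE : Cov g P c X Y t E =
  \int[P]_w inner g (c t) (transport g c 0 t (rlog g (c 0) (X w)))
                          (transport g c 1 t (rlog g (c 1) (Y w))).
Proof.
pose U w := transport g c 0 t (rlog g (c 0) (X w)).
pose V w := transport g c 1 t (rlog g (c 1) (Y w)).
pose xy (a : 'I_n) w :=
  inner g (c t) (U w) (row a E) * inner g (c t) (V w) (row a E).
have bessel u a : inner g (c t) u (row a E) ^+ 2 <= inner g (c t) u u.
  rewrite (inner_parseval u u EP) (bigD1 a)//= expr2 lerDl.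
  by apply: sumr_ge0 => b _; rewrite -expr2 sqr_ge0.
have intxy a : P.-integrable setT (EFin \o xy a).
  (* The dominating function is |log X|^2 + |log Y|^2: the bound |xy| <= x^2 + y^2 is followed by
     Bessel's inequality and by [transport_norm]. *)
  apply: (le_integrable _ _ _ (integrableD measurableT
    (integrable_inner_rlog mX meanX ballX)
    (integrable_inner_rlog mY meanY ballY))) => //.
    apply/measurable_EFinP; apply: measurable_funM.
      exact: measurable_transport_rlog.
    exact: measurable_transport_rlog.
  move=> w _ /=; rewrite lee_fin normrM.
  rewrite [leRHS]ger0_norm ?addr_ge0 ?inner_ge0//.
  apply: (@le_trans _ _ (`|inner g (c t) (U w) (row a E)| ^+ 2 +
    `|inner g (c t) (V w) (row a E)| ^+ 2)).
    move: (`|_|) (normr_ge0 (inner g (c t) (U w) (row a E))) => x x0.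
    move: (`|_|) (normr_ge0 (inner g (c t) (V w) (row a E))) => y y0.
    by nra.
  rewrite !real_normK ?num_real//; apply: lerD.
    exact: le_trans (bessel _ a) (transport_norm cC1 0 t _).
  exact: le_trans (bessel _ a) (transport_norm cC1 1 t _).
transitivity (\sum_a \int[P]_w xy a w).
  apply: eq_bigr => a _; rewrite mxE; apply: eq_Rintegral => w _.
  by rewrite mxE big_ord1 !mxE.
rewrite -Rintegral_sum//; apply: eq_Rintegral => w _.
by rewrite (inner_parseval _ _ EP).
Qed.

End CovarianceFormula.

Unset Implicit Arguments.

Theorem theorem3p6 (R : realType) (n : nat) (M : topologicalType)
  (g : riemannian R n M)
  (Mcompact : compact [set: M]) (Mcomplete : complete_manifold g)
  (d : measure_display) (Omega : measurableType d) (P : probability Omega R)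
  (X Y : Omega -> M) (mX : random_point X) (mY : random_point Y)
  (mu nu : M)
  (meanX : unique_frechet_mean g P X mu) (meanY : unique_frechet_mean g P Y nu)
  (kappa : R) (kappaP : sectional_curvature_le g kappa)
  (pX pY : M) (rX rY : R)
  (ballX : in_geodesic_ball g P X pX rX) (ballY : in_geodesic_ball g P Y pY rY)
  (radX : 0 < kappa -> (rX%:E <=
     (2^-1)%:E * Order.min (inj_radius g) (pi / Num.sqrt kappa)%:E)%E)
  (radY : 0 < kappa -> (rY%:E <=
     (2^-1)%:E * Order.min (inj_radius g) (pi / Num.sqrt kappa)%:E)%E)
  (munu : (dist g mu nu < inj_radius g)%E)
  (alpha : R -> M) (alphaP : minimizing_geodesic g alpha mu nu)
  (s t : R) (sI : 0 <= s <= 1) (tI : 0 <= t <= 1)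
  (E F : 'M[R]_n) (EP : orthonormal_basis g (alpha s) E)
  (FP : orthonormal_basis g (alpha t) F) :
  Cov g P alpha X Y s E = Cov g P alpha X Y t F.
Proof.
have [[aC _] a0 a1 _] := alphaP; rewrite -a0 in meanX; rewrite -a1 in meanY.
rewrite (CovE aC mX mY meanX meanY ballX ballY EP).
rewrite (CovE aC mX mY meanX meanY ballX ballY FP).
(* The bases E and F no longer occur, and the integrands agree for every outcome w. *)
by apply: eq_Rintegral => w _; exact: transport_inner.
Qed.
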